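(* Let $\omega=(\omega_x)_{x\in\mathbb{Z}}$ be a random environment, i.e. a sequence of i.i.d. random variables with values in $(0,1)$ under a probability measure $\mathsf{P}$, such that, with $\rho_0:=\frac{1-\omega_0}{\omega_0}$: (i) $\mathsf{E}[\log\rho_0]=0$; (ii) $\mathsf{P}(\varepsilon\le\omega_0\le 1-\varepsilon)=1$ for some $\varepsilon\in(0,\tfrac12)$; (iii) $\mathsf{Var}(\log\rho_0)>0$. Let $(X_n)_{n\in\mathbb{N}_0}$ be the random walk in the environment $\omega$ started at $0$, with quenched law $P_\omega$. Then for every $0\le\alpha<1$, $$\sum_{n\in\mathbb{N}}P_\omega(X_{2n}=0)\cdot n^{-\alpha}=\infty$$ for $\mathsf{P}$-a.e. environment $\omega$.
   Context: $\mathbb{N}=\{1,2,\dots\}$, $\mathbb{N}_0=\mathbb{N}\cup\{0\}$. For a fixed environment $\omega=(\omega_x)_{x\in\mathbb{Z}}\in(0,1)^{\mathbb{Z}}$ and $x\in\mathbb{Z}$, under $P_\omega^x$ the process $(X_n)_{n\in\mathbb{N}_0}$ is the Markov chain on $\mathbb{Z}$ with $P_\omega^x(X_0=x)=1$ and $P_\omega^x(X_{n+1}=y+1\mid X_n=y)=\omega_y=1-P_\omega^x(X_{n+1}=y-1\mid X_n=y)$ for all $y\in\mathbb{Z}$. $P_\omega:=P_\omega^0$. *)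

(* Defs.v *)
From HB Require Import structures.
From mathcomp Require Import all_boot all_order all_algebra.
From mathcomp Require Import all_classical all_reals all_analysis.

Set Implicit Arguments.
Unset Strict Implicit.
Unset Printing Implicit Defensive.

Import Order.TTheory GRing.Theory Num.Theory.
Import numFieldNormedType.Exports.

Local Open Scope classical_set_scope.
Local Open Scope ring_scope.

Section iid.
Context {d : measure_display} {T : measurableType d} {R : realType}.
Variables (P : probability T R) (I : choiceType).

Definition mutually_independent (Y : I -> {RV P >-> R}) : Prop :=
  forall (s : seq I) (B : I -> set R), uniq s ->
    (forall i, measurable (B i)) ->
    P (\bigcap_(i in [set` s]) (Y i @^-1` B i)) =
    (\prod_(i <- s) P (Y i @^-1` B i))%E.

(* The laws are compared on Borel sets only: the value of a measure of the
   library on a non-measurable set is unspecified. *)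
Definition identically_distributed (Y : I -> {RV P >-> R}) : Prop :=
  forall (i j : I) (B : set R), measurable B ->
    distribution P (Y i) B = distribution P (Y j) B.

Definition iid (Y : I -> {RV P >-> R}) : Prop :=
  mutually_independent Y /\ identically_distributed Y.

End iid.

Definition random_environment {d : measure_display} {T : measurableType d}
    {R : realType} (P : probability T R) (omega : int -> {RV P >-> R}) : Prop :=
  iid omega /\ (forall x t, 0 < omega x t < 1).

Definition rho {R : realType} (p : R) : R := (1 - p) / p.

Section quenched_walk.
Context {d : measure_display} {T : measurableType d} {R : realType}.
Variable (Q : probability T R).

(* Equal to 0 by convention when Q B = 0; only used when 0 < Q B. *)
Definition cond_prob (A B : set T) : R := fine (Q (A `&` B)) / fine (Q B).

(* Measurability for the discrete sigma-algebra on int. *)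
Definition int_process (X : nat -> T -> int) : Prop :=
  forall n (B : set int), measurable (X n @^-1` B).

Definition markov_property (X : nat -> T -> int) : Prop :=
  forall (n : nat) (p : nat -> int) (z : int),
    let past := [set t | forall k, (k <= n)%N -> X k t = p k] in
    (0 < Q past)%E ->
    cond_prob [set t | X n.+1 t = z] past =
    cond_prob [set t | X n.+1 t = z] [set t | X n t = p n].

Definition walk_in_environment (w : int -> R) (x : int) (X : nat -> T -> int) :
    Prop :=
  [/\ int_process X,
      Q [set t | X 0%N t = x] = 1%E,
      markov_property X &
      forall (n : nat) (y : int), (0 < Q [set t | X n t = y])%E ->
        cond_prob [set t | X n.+1 t = y + 1] [set t | X n t = y] = w y /\
        w y = 1 - cond_prob [set t | X n.+1 t = y - 1] [set t | X n t = y]].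

End quenched_walk.

(* Main.v *)
(* Let V be the potential, with increments ln rho, and pi ~ exp (- V) the
   reversible measure of the walk, normalised by pi 0 = 1. Suppose that V
   reaches the height h at - a and at b, and stays above - delta h in between.
   Kill the walk at - a and at b, and let f_n be the density of its time n law
   with respect to pi. The maximum principle gives f_n <= 1, so the mass killed
   at each step is at most pi (- a) + pi b ~ exp (- h); up to a time of order
   exp h half of the mass survives. By reversibility and Cauchy-Schwarz,
   P (X_2n = 0) >= f_2n 0 = |f_n|^2_pi >= (mass)^2 / pi [-a, b], which is at
   least exp (- 2 delta h) if the valley has width at most exp (delta h). Such
   a valley thus contributes exp ((1 - alpha - 2 delta) h) to the series.

   There are almost surely infinitely many valleys: cut the two half-lines into
   disjoint blocks whose lengths grow so fast that the potential accumulated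
   before a block is negligible. In each block, optional stopping for S_n and
   S_n^2 - n Var bounds from below the probability that the potential climbs by
   2h before it descends by delta h / 2, and the blocks are independent. *)

Require Import Defs.
From HB Require Import structures.
From mathcomp Require Import all_boot all_order all_algebra.
From mathcomp Require Import all_classical all_reals all_analysis.
From mathcomp Require Import measurable_realfun ring lra zify.

Set Implicit Arguments.
Unset Strict Implicit.
Unset Printing Implicit Defensive.

Import Order.TTheory GRing.Theory Num.Theory.
Import numFieldNormedType.Exports.

Local Open Scope classical_set_scope.
Local Open Scope ring_scope.

(** * The walk killed outside an interval *)

Section killed_walk.
Variables (R : realType) (p pi : nat -> R) (L o : nat).
Hypotheses (p01 : forall i, 0 <= p i <= 1) (pi_ge0 : forall i, 0 <= pi i).
Hypothesis balance : forall i, pi i * p i = pi i.+1 * (1 - p i.+1).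
Hypotheses (o_int : (0 < o < L)%N) (pi_o : pi o = 1).

Definition killed_step (f : nat -> R) (i : nat) : R :=
  if (0 < i < L)%N then p i * f i.+1 + (1 - p i) * f i.-1 else 0.

(** Backward iteration from the indicator of [o]. By detailed balance and [pi o = 1] it is also the
    density with respect to [pi] of the time [n] law of the killed walk started at [o]. *)
Definition killed_heat (n : nat) : nat -> R :=
  iter n killed_step (fun i => (i == o)%:R).

Definition killed (f : nat -> R) := forall i, ~~ (0 < i < L)%N -> f i = 0.

Definition pi_dot (f g : nat -> R) := \sum_(i < L.+1) pi i * (f i * g i).

Definition pi_mass (f : nat -> R) := \sum_(i < L.+1) pi i * f i.

Lemma killed_step_killed f : killed (killed_step f).
Proof. by move=> i /negbTE ii; rewrite /killed_step ii. Qed.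

Lemma killed_heat_killed n : killed (killed_heat n).
Proof.
case: n => [|n] i ii /=; last exact: killed_step_killed.
by case: eqP ii => // ->; rewrite o_int.
Qed.

Lemma killed_heat01 n i : 0 <= killed_heat n i <= 1.
Proof.
elim: n i => [|n IH] i /=; first by rewrite ler0n lern1 leq_b1.
rewrite /killed_step; case: ifP => _; last by rewrite lexx ler01.
move: (IH i.+1) (IH i.-1) (p01 i).
move: (killed_heat n i.+1) (killed_heat n i.-1) => a b.
by move=> ? ? ?; apply/andP; split; nra.
Qed.

(** Sites are regrouped into edges: by [balance] both directions of the edge from [i] to [i.+1]
    carry the conductance [pi i * p i]. The outcome is symmetric in [f] and [g], whence
    self-adjointness. *)
Lemma pi_dot_killed_step f g : killed f -> killed g ->
  pi_dot g (killed_step f) =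
  \sum_(i < L) pi i * p i * (g i * f i.+1 + g i.+1 * f i).
Proof.
move=> kf kg.
have -> : pi_dot g (killed_step f) = \sum_(i < L.+1)
   (pi i * p i * (g i * f i.+1) + pi i * (1 - p i) * (g i * f i.-1)).
  apply: eq_bigr => i _; rewrite /killed_step.
  by case: ifPn => [_|/kg ->]; ring.
rewrite big_split /= big_ord_recr /= (kg L); last by rewrite ltnn andbF.
rewrite [X in _ + X]big_ord_recl (kg ord0)// !mul0r !mulr0 addr0 add0r.
rewrite -big_split /=; apply: eq_bigr => i _.
by rewrite balance; ring.
Qed.

Lemma pi_dot_sym f g : killed f -> killed g ->
  pi_dot g (killed_step f) = pi_dot (killed_step g) f.
Proof.
move=> kf kg; rewrite pi_dot_killed_step//.
have -> : pi_dot (killed_step g) f = pi_dot f (killed_step g).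
  by apply: eq_bigr => i _; rewrite [killed_step g i * _]mulrC.
by rewrite pi_dot_killed_step//; apply: eq_bigr => i _; ring.
Qed.

Lemma pi_dot_heat n m k :
  pi_dot (killed_heat (n + m)) (killed_heat k) =
  pi_dot (killed_heat n) (killed_heat (m + k)).
Proof.
elim: m n => [|m IH] n; first by rewrite addn0.
rewrite addnS -addSn IH /=.
by rewrite -pi_dot_sym//; exact: killed_heat_killed.
Qed.

(** Pairing with [killed_heat 0], the indicator of [o], evaluates at [o] because [pi o = 1];
    self-adjointness then shares the steps equally between the two factors. *)
Lemma killed_heat_diag n :
  killed_heat (n + n) o = pi_dot (killed_heat n) (killed_heat n).
Proof.
have oL : (o < L.+1)%N by case/andP: o_int => _ /ltnW.
rewrite -{4}(addn0 n) -pi_dot_heat /pi_dot (bigD1 (Ordinal oL)) //=.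
rewrite pi_o eqxx mulr1 mul1r big1 ?addr0// => i /negbTE.
rewrite -val_eqE /= => ->.
by rewrite !mulr0.
Qed.

Lemma pi_mass_killed f : killed f ->
  pi_mass f = \sum_(i < L) pi i * p i * (f i + f i.+1).
Proof.
move=> kf.
have -> : pi_mass f = \sum_(i < L.+1)
   (pi i * p i * f i + pi i * (1 - p i) * f i).
  by apply: eq_bigr => i _; ring.
rewrite big_split /= big_ord_recr /= (kf L); last by rewrite ltnn andbF.
rewrite [X in _ + X]big_ord_recl (kf ord0)// !mulr0 addr0 add0r.
rewrite -big_split /=; apply: eq_bigr => i _.
by rewrite balance; ring.
Qed.

(** Mass leaks only through the two extreme edges, whose conductances are at most [pi 0] and
    [pi L]. *)
Lemma pi_mass_killed_step f : killed f -> (forall i, f i <= 1) ->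
  pi_mass f - (pi 0%N + pi L) <= pi_mass (killed_step f).
Proof.
move=> kf f1.
pose g i : R := (0 < i < L)%N%:R.
have kg : killed g by move=> i /negbTE ii; rewrite /g ii.
have -> : pi_mass (killed_step f) = pi_dot g (killed_step f).
  apply: eq_bigr => i _; rewrite /g /killed_step.
  by case: ifP => _; rewrite ?mul1r// mul0r.
rewrite pi_dot_killed_step// pi_mass_killed// lerBlDl -lerBlDr -sumrB.
have [l Ll] : exists l, L = l.+1.
  by case: (L) o_int => [|l _]; [rewrite ltn0 andbF|exists l].
have -> : \sum_(i < L) (pi i * p i * (f i + f i.+1) -
    pi i * p i * (g i * f i.+1 + g i.+1 * f i)) =
  \sum_(i < L) pi i * p i * ((1 - g i) * f i.+1) +
  \sum_(i < L) pi i * p i * ((1 - g i.+1) * f i).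
  by rewrite -big_split; apply: eq_bigr => i _ /=; ring.
apply: lerD.
- rewrite Ll big_ord_recl big1 => [|i _].
    rewrite addr0 /g /= subr0 mul1r; have /andP[p0 p1] := p01 0; have := f1 1%N.
    have : 0 <= pi 0%N * p 0%N by rewrite mulr_ge0.
    have := pi_ge0 0; nra.
  have -> : g (lift ord0 i) = 1 by rewrite /g lift0 Ll /= ltnS (ltn_ord i).
  by rewrite subrr mul0r mulr0.
- rewrite Ll big_ord_recr big1 => [|i _] /=.
    rewrite add0r /g Ll ltnn andbF subr0 mul1r balance.
    have /andP[p0 p1] := p01 l.+1; have := f1 l.
    have : 0 <= pi l.+1 * (1 - p l.+1) by rewrite mulr_ge0// subr_ge0.
    have := pi_ge0 l.+1; nra.
  by rewrite /g Ll /= ltnS (ltn_ord i) subrr mul0r mulr0.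
Qed.

Lemma pi_mass_heat n :
  1 - n%:R * (pi 0%N + pi L) <= pi_mass (killed_heat n).
Proof.
elim: n => [|n IH].
  have oL : (o < L.+1)%N by case/andP: o_int => _ /ltnW.
  rewrite mul0r subr0 /pi_mass (bigD1 (Ordinal oL)) //= eqxx pi_o mulr1.
  by rewrite lerDl sumr_ge0// => i _; rewrite mulr_ge0.
have := @pi_mass_killed_step (killed_heat n) (killed_heat_killed n)
  (fun i => proj2 (andP (killed_heat01 n i))).
apply: le_trans.
by rewrite -natr1; lra.
Qed.

(* Cauchy--Schwarz in [l^2(pi)], applied to [killed_heat n] and [1]. *)
Lemma killed_heat_diag_ge n (S : R) : 0 < S -> \sum_(i < L.+1) pi i <= S ->
  n%:R * (pi 0%N + pi L) <= 1 / 2 -> 1 / (4 * S) <= killed_heat (n + n) o.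
Proof.
move=> S0 piS nle; rewrite killed_heat_diag.
have := pi_mass_heat n; set m := pi_mass _ => mge.
have m2 : 1 / 2 <= m by lra.
(* The squared [pi]-distance to a constant is nonnegative; [1 / (2 * S)] is the best constant when
   the mass is [1 / 2] and the total measure is [S]. *)
have : 0 <= \sum_(i < L.+1) pi i * (killed_heat n i - 1 / (2 * S)) ^+ 2.
  by apply: sumr_ge0 => i _; rewrite mulr_ge0// sqr_ge0.
have -> : \sum_(i < L.+1) pi i * (killed_heat n i - 1 / (2 * S)) ^+ 2 =
   pi_dot (killed_heat n) (killed_heat n) - 1 / S * m +
   (1 / (2 * S)) ^+ 2 * (\sum_(i < L.+1) pi i).
  rewrite /pi_dot /m /pi_mass 2!mulr_sumr -sumrB -big_split/=.
  by apply: eq_bigr => i _; field; rewrite gt_eqF.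
have : (1 / (2 * S)) ^+ 2 * (\sum_(i < L.+1) pi i) <= 1 / (4 * S).
  have -> : 1 / (4 * S) = (1 / (2 * S)) ^+ 2 * S by field; rewrite gt_eqF.
  by rewrite ler_wpM2l// sqr_ge0.
have : 1 / (2 * S) <= 1 / S * m.
  have -> : 1 / (2 * S) = 1 / S * (1 / 2) by field; rewrite gt_eqF.
  by rewrite ler_wpM2l// divr_ge0// ltW.
have -> : 1 / (2 * S) = 2 * (1 / (4 * S)) by field; rewrite gt_eqF.
lra.
Qed.

End killed_walk.

(** * Valleys of the potential *)

Section environment_potential.
Context {R : realType}.
Variables (w : int -> R) (eps : R).
Hypothesis eps_gt0 : 0 < eps.
Hypothesis w_elliptic : forall x, eps <= w x <= 1 - eps.

(** Both potentials skip site 0: one reads the sites [1 .. m], the other [- m .. - 1], hence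
    disjoint coordinates. This costs only a bounded factor in [reversible]. *)
Definition right_potential (m : nat) : R := \sum_(j < m) ln (rho (w j.+1%:Z)).

Definition left_potential (m : nat) : R :=
  \sum_(j < m) - ln (rho (w (- j.+1%:Z))).

(** Detailed balance iterated away from 0, where the value is 1. [Negz m] is [- m.+1], hence the
    [m.+1] factors. *)
Definition reversible (x : int) : R :=
  match x with
  | Posz m => \prod_(j < m) (w j%:Z / (1 - w j.+1%:Z))
  | Negz m => \prod_(j < m.+1) ((1 - w (- j%:Z)) / w (- j.+1%:Z))
  end.

Let w_gt0 x : 0 < w x.
Proof. by have /andP[h _] := w_elliptic x; exact: lt_le_trans h. Qed.

Let w_lt1 x : 0 < 1 - w x.
Proof. by have /andP[_ h] := w_elliptic x; have := eps_gt0; lra. Qed.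

Lemma reversibleN m :
  reversible (- m%:Z) = \prod_(j < m) ((1 - w (- j%:Z)) / w (- j.+1%:Z)).
Proof. by case: m => [|m]; rewrite ?oppr0 /= ?big_ord0// -NegzE. Qed.

Lemma reversible_gt0 x : 0 < reversible x.
Proof. by case: x => m; apply: prodr_gt0 => j _; rewrite divr_gt0. Qed.

Lemma reversible_balance x :
  reversible x * w x = reversible (x + 1) * (1 - w (x + 1)).
Proof.
case: x => m.
  have -> : m%:Z + 1 = m.+1%:Z by rewrite -addn1 PoszD.
  by rewrite /= big_ord_recr /=; field; rewrite gt_eqF.
have -> : Negz m + 1 = - m%:Z by rewrite NegzE; lia.
rewrite reversibleN /= big_ord_recr /= NegzE.
by field; rewrite gt_eqF.
Qed.

(** The left side is the conductance of the edge from [m] to [m + 1]; passing to the next edge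
    divides it by [rho (w (m + 1))]. *)
Lemma reversible_right m :
  reversible m%:Z * w m%:Z = w 0 * expR (- right_potential m).
Proof.
rewrite /right_potential /=; elim: m => [|m IH].
  by rewrite !big_ord0 oppr0 expR0 mulrC.
rewrite big_ord_recr /= mulrA IH big_ord_recr /= opprD expRD.
rewrite [expR (- ln _)]expRN lnK; last by rewrite posrE /rho divr_gt0.
by rewrite /rho; field; rewrite !gt_eqF.
Qed.

Lemma reversible_left m : reversible (- m%:Z) * (1 - w (- m%:Z)) =
  (1 - w 0) * expR (- left_potential m).
Proof.
rewrite reversibleN /left_potential; elim: m => [|m IH].
  by rewrite !big_ord0 !oppr0 expR0 mulrC.
rewrite big_ord_recr /= [X in X * _](_ : _ =
  \prod_(j < m) ((1 - w (- j%:Z)) / w (- j.+1%:Z)) * (1 - w (- m%:Z)) /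
  w (- m.+1%:Z)); last by rewrite mulrA.
rewrite IH big_ord_recr /= opprD expRD opprK lnK; last first.
  by rewrite posrE /rho divr_gt0.
by rewrite /rho; field; rewrite gt_eqF.
Qed.

Lemma reversible_right_le m :
  reversible m%:Z <= eps^-1 * expR (- right_potential m).
Proof.
rewrite ler_pdivlMl//; have := reversible_right m.
have /andP[e0 e1] := w_elliptic 0; have /andP[m0 m1] := w_elliptic m%:Z.
have := reversible_gt0 m%:Z; have := expR_gt0 (- right_potential m).
have := eps_gt0; nra.
Qed.

Lemma reversible_left_le m :
  reversible (- m%:Z) <= eps^-1 * expR (- left_potential m).
Proof.
rewrite ler_pdivlMl//; have := reversible_left m.
have /andP[e0 e1] := w_elliptic 0; have /andP[m0 m1] := w_elliptic (- m%:Z).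
have := reversible_gt0 (- m%:Z); have := expR_gt0 (- left_potential m).
have := eps_gt0; nra.
Qed.

(** * Comparison of the walk with the killed walk *)

Section quenched_lower_bound.
Context {d : measure_display} {T : measurableType d}.
Variables (Q : probability T R) (X : nat -> T -> int).
Hypothesis walkX : walk_in_environment Q w 0 X.

Let q n y := fine (Q [set t | X n t = y]).

Let mX n y : measurable [set t | X n t = y].
Proof. by have [iX _ _ _] := walkX; exact: (iX n [set y]). Qed.

(** If [Q B = 0], the conventional value of [cond_prob] does no harm, as the intersection is then
    null too. *)
Let cond_probM (A B : set T) : measurable A -> measurable B ->
  cond_prob Q A B * fine (Q B) = fine (Q (A `&` B)).
Proof.
move=> mA mB; rewrite /cond_prob; have [QB0|QB0] := eqVneq (fine (Q B)) 0.
  rewrite QB0 mulr0; apply/esym/eqP; rewrite eq_le fine_ge0// andbT -QB0.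
  apply: fine_le; rewrite ?fin_num_measure//; first exact: measurableI.
  by apply: le_measure; rewrite ?inE//; exact: measurableI.
by rewrite divfK.
Qed.

(** Arrivals from [y - 1] and from [y + 1] are disjoint parts of the event on the right; an
    inequality is enough for lower bounds. *)
Lemma walk_step n (y : int) :
  w (y - 1) * q n (y - 1) + (1 - w (y + 1)) * q n (y + 1) <= q n.+1 y.
Proof.
have [_ _ _ trX] := walkX.
have up : w (y - 1) * q n (y - 1) =
    fine (Q ([set t | X n.+1 t = y] `&` [set t | X n t = y - 1])).
  rewrite -cond_probM//.
  have [Q0|Q0] := eqVneq (Q [set t | X n t = y - 1]) 0%E.
    by rewrite /q Q0 !mulr0.
  have /trX[<- _] : (0 < Q [set t | X n t = (y - 1)%R])%E
    by rewrite lt0e Q0 measure_ge0.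
  by rewrite subrK.
have down : (1 - w (y + 1)) * q n (y + 1) =
    fine (Q ([set t | X n.+1 t = y] `&` [set t | X n t = y + 1])).
  rewrite -cond_probM//.
  have [Q0|Q0] := eqVneq (Q [set t | X n t = y + 1]) 0%E.
    by rewrite /q Q0 !mulr0.
  have /trX[_ ->] : (0 < Q [set t | X n t = (y + 1)%R])%E
    by rewrite lt0e Q0 measure_ge0.
  by rewrite addrK subKr.
rewrite up down -fineD ?fin_num_measure//; [|exact: measurableI..].
rewrite -measureU//; [|exact: measurableI..|]; last first.
  by apply/seteqP; split => t //= [[_ ->] [_]]; lia.
have mU : measurable (([set t | X n.+1 t = y] `&` [set t | X n t = y - 1]) `|`
    ([set t | X n.+1 t = y] `&` [set t | X n t = y + 1])).
  by apply: measurableU; exact: measurableI.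
apply: fine_le; rewrite ?fin_num_measure//.
by apply: le_measure; rewrite ?inE// => t [[]|[]].
Qed.

Variables a b : nat.
Hypotheses (a_gt0 : (0 < a)%N) (b_gt0 : (0 < b)%N).

(** Moves the interval from [- a] to [b] onto [0 .. a + b], so that the origin becomes site number
    [a]. *)
Let site (i : nat) : int := i%:Z - a%:Z.
Let p i := w (site i).
Let pi i := reversible (site i).

Let siteS i : site i.+1 = site i + 1.
Proof. by rewrite /site; lia. Qed.

Let p01 i : 0 <= p i <= 1.
Proof. by have := w_gt0 (site i); have := w_lt1 (site i); rewrite /p; lra. Qed.

Let pi_ge0 i : 0 <= pi i.
Proof. exact/ltW/reversible_gt0. Qed.

Let balance i : pi i * p i = pi i.+1 * (1 - p i.+1).
Proof. by rewrite /pi /p siteS reversible_balance. Qed.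

(** The left side is the law of the killed walk, and killing only loses mass. Detailed balance turns
    the backward step of [killed_heat] into the forward step of [walk_step]. *)
Lemma walk_ge_killed_heat n i :
  pi i * killed_heat p (a + b) a n i <= q n (site i).
Proof.
elim: n i => [|n IH] i /=.
  case: eqP => [->|_]; last by rewrite mulr0 fine_ge0.
  have [_ X0 _ _] := walkX.
  by rewrite mulr1 /pi /q /site subrr X0 /= big_ord0.
rewrite /killed_step; case: ifP => [|_]; last by rewrite mulr0 fine_ge0.
case: i => // i _; rewrite [i.+1.-1]/=.
have -> : pi i.+1 * (p i.+1 * killed_heat p (a + b) a n i.+2 +
     (1 - p i.+1) * killed_heat p (a + b) a n i) =
   (1 - p i.+2) * (pi i.+2 * killed_heat p (a + b) a n i.+2) +
   p i * (pi i * killed_heat p (a + b) a n i).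
  by rewrite mulrDr !mulrA (balance i.+1) -(balance i); ring.
apply: le_trans (walk_step n (site i.+1)).
have -> : site i.+1 - 1 = site i by rewrite siteS addrK.
rewrite -siteS addrC lerD//.
- by rewrite ler_wpM2l//; have /andP[] := p01 i.
- by rewrite ler_wpM2l// subr_ge0; have /andP[] := p01 i.+2.
Qed.

(** At both ends [pi] is at most [eps^-1 * expR (- h)], so the last hypothesis keeps the killed mass
    below one half; each of the [(a + b).+1] sites has measure at most [eps^-1 * expR l]. *)
Lemma return_probability_ge (h l : R) n :
  h <= right_potential b -> h <= left_potential a ->
  (forall m, (m <= b)%N -> - l <= right_potential m) ->
  (forall m, (m <= a)%N -> - l <= left_potential m) ->
  n%:R * (2 * (eps^-1 * expR (- h))) <= 1 / 2 ->
  1 / (4 * ((a + b).+1%:R * (eps^-1 * expR l))) <= q (2 * n) 0.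
Proof.
move=> hb ha lb la nle.
have -> : q (2 * n) 0 = q (n + n) (site a) by rewrite mul2n addnn /site subrr.
apply: le_trans (walk_ge_killed_heat (n + n) a).
have pia : pi a = 1 by rewrite /pi /site subrr /= big_ord0.
have e0 : 0 < eps^-1 by rewrite invr_gt0.
have aL : (0 < a < a + b)%N by rewrite a_gt0 -[X in (X < _)%N]addn0 ltn_add2l.
rewrite pia [1 * killed_heat _ _ _ _ _]mul1r.
apply: (killed_heat_diag_ge p01 pi_ge0 balance aL pia).
- by rewrite mulr_gt0// mulr_gt0// expR_gt0.
- have -> : (a + b).+1%:R * (eps^-1 * expR l) =
      \sum_(i < (a + b).+1) (eps^-1 * expR l).
    by rewrite sumr_const card_ord mulr_natl.
  apply: ler_sum => -[i ilt] _ /=.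
  have [ai|ia] := leqP a i.
    have -> : pi i = reversible (i - a)%N%:Z by rewrite /pi /site subzn.
    apply: le_trans (reversible_right_le _) _.
    rewrite ler_pM2l// ler_expR lerNl; apply: lb; lia.
  have -> : pi i = reversible (- (a - i)%N%:Z).
    by rewrite /pi /site; congr reversible; lia.
  apply: le_trans (reversible_left_le _) _.
  rewrite ler_pM2l// ler_expR lerNl; apply: la; lia.
- apply: le_trans nle; rewrite ler_wpM2l//.
  have -> : pi 0%N = reversible (- a%:Z) by rewrite /pi /site sub0r.
  have -> : pi (a + b)%N = reversible b%:Z.
    by rewrite /pi /site; congr reversible; lia.
  rewrite mulr_natl mulr2n; apply: lerD.
    apply: le_trans (reversible_left_le _) _.
    by rewrite ler_pM2l// ler_expR lerN2.
  apply: le_trans (reversible_right_le _) _.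
  by rewrite ler_pM2l// ler_expR lerN2.
Qed.

End quenched_lower_bound.

(* The origin lies at the bottom, up to [delta * h], of a valley of depth [h]
   and of width subexponential in [h]. *)
Definition valley (delta h : R) : Prop := exists a b : nat,
  [/\ (0 < a)%N /\ (0 < b)%N,
      h <= right_potential b /\ h <= left_potential a,
      forall m, (m <= b)%N -> - (delta * h) <= right_potential m,
      forall m, (m <= a)%N -> - (delta * h) <= left_potential m &
      (a + b).+1%:R <= expR (delta * h)].

(** A single deep enough valley already makes a partial sum exceed any given [A]. *)
Lemma valleys_divergence (alpha : R) (d : measure_display)
    (T : measurableType d) (Q : probability T R) (X : nat -> T -> int) :
  0 <= alpha < 1 -> walk_in_environment Q w 0 X ->
  (forall h0, exists2 h, h0 <= h & valley ((1 - alpha) / 4) h) ->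
  (\sum_(1 <= n <oo)
     (Q [set s | X (2 * n)%N s = 0%R] * (n%:R `^ (- alpha))%R%:E) = +oo)%E.
Proof.
move=> /andP[alpha0 alpha1] walkX valleys; apply: eq_infty => A.
set delta := (1 - alpha) / 4 in valleys.
have delta0 : 0 < delta by rewrite /delta divr_gt0// subr_gt0.
have eps1 : eps <= 1 by have /andP[] := w_elliptic 0; have := eps_gt0; lra.
(* The factor [eps / 8] comes from the number of terms, [eps / 4] from the return probability in
   each. *)
pose c := eps / 8 * (eps / 4).
have c0 : 0 < c by rewrite /c mulr_gt0// divr_gt0.
(* The first threshold gives [8 <= eps * expR h], so that truncating to [N] loses at most half; the
   second gives [A <= c * (2 * delta * h)]. *)
have [h hge [a [b [[a0 b0] [hb ha] lb la width]]]] :=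
  valleys (Num.max (8 / eps) (A / (2 * delta * c))).
move: hge; rewrite ge_max => /andP[h1 h2].
have h0 : 0 <= h by apply: le_trans h1; rewrite divr_ge0// ltW.
have E1 : 8 / eps <= expR h.
  by apply: le_trans (expR_ge1Dx h); lra.
have {E1} E8 : 8 <= eps * expR h by rewrite mulrC -ler_pdivrMr.
(* The last time allowed by [return_probability_ge]. *)
pose N := Num.trunc (eps * expR h / 4).
have /andP[N1 N2] : N%:R <= eps * expR h / 4 < N.+1%:R.
  by apply: truncn_itv; rewrite divr_ge0// mulr_ge0 ?expR_ge0// ltW.
have N3 : eps * expR h / 8 <= N%:R.
  by move: N2; rewrite -[N.+1%:R]natr1; lra.
apply: (le_trans _ (nneseries_lim_ge N.+1 _)); last first.
  by move=> n _ _; rewrite mule_ge0// lee_fin powR_ge0.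
(* Lower bound for each term up to [N]: the width and the bottom of the valley each cost a factor
   [expR (delta * h)], and [n <= N <= expR h] controls the power of [n]. *)
pose v := eps / 4 * expR (- (2 * delta * h)) * expR (- (alpha * h)).
have vle n : (1 <= n < N.+1)%N ->
    (v%:E <= Q [set s | X (2 * n)%N s = 0%R] * (n%:R `^ (- alpha))%:E)%E.
  move=> /andP[n1 n2].
  have nN : n%:R <= N%:R :> R by rewrite ler_nat -ltnS.
  have mX : measurable [set s | X (2 * n)%N s = 0%R].
    by have [iX _ _ _] := walkX; exact: (iX _ [set 0]).
  rewrite -[Q _]fineK ?fin_num_measure// -EFinM lee_fin /v.
  apply: ler_pM; rewrite ?mulr_ge0 ?expR_ge0 ?divr_ge0 ?(ltW eps_gt0)//.
    apply: le_trans (return_probability_ge (h := h) (l := delta * h) (n := n)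
      walkX a0 b0 hb ha lb la _).
      rewrite [X in _ <= X](_ : _ =
        eps / 4 * (expR (delta * h))^-1 * ((a + b).+1%:R)^-1); last first.
        by field; rewrite !gt_eqF//= ?expR_gt0.
      have -> : 2 * delta * h = delta * h + delta * h by ring.
      rewrite opprD expRD !expRN mulrA ler_wpM2l//.
        by rewrite mulr_ge0 ?invr_ge0 ?expR_ge0// divr_ge0// ltW.
      by rewrite lef_pV2 ?posrE ?expR_gt0.
    rewrite [leRHS](_ : _ = eps * expR h / 4 * (2 * (eps^-1 * expR (- h)))).
      rewrite ler_wpM2r ?(le_trans nN)// !mulr_ge0 ?expR_ge0// invr_ge0.
      exact: ltW.
    by rewrite expRN; field; rewrite !gt_eqF//= expR_gt0.
  have n0 : 0 < n%:R :> R by rewrite ltr0n.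
  rewrite /powR gt_eqF// ler_expR mulNr lerN2 ler_wpM2l//.
  rewrite -[h]expRK ler_ln ?posrE ?expR_gt0//.
  apply: (le_trans nN); apply: (le_trans N1).
  by have := expR_gt0 h; nra.
rewrite [leRHS](_ : _ = \sum_(1 <= n < N.+1 | (1 <= n < N.+1)%N)
    (Q [set s | X (2 * n)%N s = 0%R] * (n%:R `^ (- alpha))%:E))%E; last first.
  rewrite big_nat_cond [RHS]big_nat_cond.
  by apply: eq_bigl => n; rewrite andbT andbb.
apply: (@le_trans _ _ (\sum_(1 <= n < N.+1 | (1 <= n < N.+1)%N) v%:E)%E);
  last exact: lee_sum.
rewrite -big_nat sumEFin lee_fin big_const_nat subn1 /=.
rewrite -[iter _ _ _]/(iter N (+%R v) 0).
rewrite iter_addr_0 -mulr_natl.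
have v0 : 0 <= v by rewrite /v !mulr_ge0 ?expR_ge0// ?divr_ge0// ltW.
apply: (@le_trans _ _ (eps * expR h / 8 * v)); last by rewrite ler_wpM2r.
(* With [delta = (1 - alpha) / 4] the exponent [1 - alpha - 2 * delta] is [2 * delta], hence
   positive. *)
have -> : eps * expR h / 8 * v = c * expR (2 * delta * h).
  have -> : 2 * delta * h = h - alpha * h - 2 * delta * h.
    by rewrite /delta; field.
  by rewrite !expRD /v /c; field.
apply: (@le_trans _ _ (c * (2 * delta * h))).
  have k0 : 0 < 2 * delta * c by apply: mulr_gt0 => //; exact: mulr_gt0.
  by move: h2; rewrite ler_pdivrMr// => h2; lra.
by rewrite ler_pM2l//; apply: le_trans (expR_ge1Dx _); rewrite lerDr.
Qed.

End environment_potential.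

(** * Independence of disjoint blocks *)

(** Rectangles are stable under intersection and generate the product sigma-algebra, so they
    determine a finite measure. *)
Lemma eq_measure_rectangles (d1 d2 : measure_display) (T1 : measurableType d1)
    (T2 : measurableType d2) (R : realType)
    (m1 m2 : {measure set (T1 * T2) -> \bar R}) :
  (m1 setT < +oo)%E ->
  (forall A B, measurable A -> measurable B -> m1 (A `*` B) = m2 (A `*` B)) ->
  forall C, measurable C -> m1 C = m2 C.
Proof.
move=> m1fin m12 C mC.
pose G : set (set (T1 * T2)) :=
  [set C | exists A, measurable A /\ exists B, measurable B /\ C = A `*` B].
apply: (measure_unique G (fun=> setT)) => //.
- rewrite measurable_prod_measurableType //; congr (<<s _ >>).
  rewrite predeqE; split => [[A mA [B mB <-]]|[A [mA [B [mB ->]]]]].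
    by exists A; split => //; exists B.
  by exists A => //; exists B.
- move=> /= _ _ [X1 [mX1 [X2 [mX2 ->]]]] [Y1 [mY1 [Y2 [mY2 ->]]]].
  rewrite -setXI; exists (X1 `&` Y1); split; first exact: measurableI.
  by exists (X2 `&` Y2); split => //; exact: measurableI.
- move=> n; exists setT; split => //; exists setT; split => //.
  by rewrite setXTT.
- by rewrite bigcup_const.
- by move=> _ [A [mA [B [mB ->]]]]; exact: m12.
Qed.

Section functions_of_blocks.
Context {d : measure_display} {T : measurableType d} {R : realType}.
Variables (P : probability T R) (I : choiceType) (Y : I -> {RV P >-> R}).
Hypothesis indepY : mutually_independent Y.

Definition cylinder (s : seq I) (B : I -> set R) : set T :=
  \bigcap_(i in [set` s]) (Y i @^-1` B i).

Definition indep_of (A : set T) (s : seq I) : Prop :=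
  forall B, (forall i, measurable (B i)) ->
    P (A `&` cylinder s B) = (P A * P (cylinder s B))%E.

(** Built from the coordinates in a list by finitely many Borel operations. If the concatenated list
    is duplicate-free, no coordinate is read twice and independence passes through [block_pair]. *)
Inductive block_fun : seq I -> (T -> R) -> Prop :=
| block_cst (c : R) : block_fun [::] (fun=> c)
| block_coord (i : I) : block_fun [:: i] (Y i)
| block_pair (s1 s2 : seq I) (f1 f2 : T -> R) (g : R * R -> R) :
    block_fun s1 f1 -> block_fun s2 f2 -> measurable_fun setT g ->
    block_fun (s1 ++ s2) (fun t => g (f1 t, f2 t)).

Lemma block_fun_measurable s f : block_fun s f -> measurable_fun setT f.
Proof.
elim=> [c|i|s1 s2 f1 f2 g _ mf1 _ mf2 mg] //.
by apply: (measurableT_comp mg); exact: measurable_fun_pair.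
Qed.

Lemma block_fun_preimage s f B : block_fun s f -> measurable B ->
  measurable (f @^-1` B).
Proof.
move=> /block_fun_measurable mf mB.
by rewrite -[X in measurable X]setTI; exact: mf.
Qed.

Lemma measurable_cylinder s B : (forall i, measurable (B i)) ->
  measurable (cylinder s B).
Proof.
move=> mB; apply: fin_bigcap_measurable => // i _.
by rewrite -[X in measurable X]setTI; apply: measurable_funPT.
Qed.

Lemma cylinder_cat s1 s2 B :
  cylinder (s1 ++ s2) B = cylinder s1 B `&` cylinder s2 B.
Proof.
rewrite /cylinder -bigcap_setU; congr (\bigcap_(i in _) _).
by apply/seteqP; split => i /=; rewrite mem_cat => /orP.
Qed.

Lemma probability_cylinder_cat s1 s2 B : uniq (s1 ++ s2) ->
  (forall i, measurable (B i)) ->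
  P (cylinder (s1 ++ s2) B) = (P (cylinder s1 B) * P (cylinder s2 B))%E.
Proof.
move=> u12 mB; have := u12; rewrite cat_uniq => /and3P[u1 _ u2].
by rewrite /cylinder !indepY// big_cat.
Qed.

Lemma indep_of_setT s : indep_of setT s.
Proof. by move=> B mB; rewrite setTI probability_setT mul1e. Qed.

Lemma cylinder_setT s : cylinder s (fun=> setT) = setT.
Proof. by apply/seteqP; split. Qed.

(** Merges cylinders over disjoint lists into a single one, to which [indep_of] applies; taking full
    sets on one part restricts to the other. *)
Definition glue (s : seq I) (B C : I -> set R) i :=
  if i \in s then B i else C i.

Lemma cylinder_glue s1 s2 B C : uniq (s1 ++ s2) ->
  cylinder (s1 ++ s2) (glue s1 B C) = cylinder s1 B `&` cylinder s2 C.
Proof.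
rewrite cat_uniq => /and3P[_ /hasPn s12 _].
rewrite cylinder_cat; congr (_ `&` _); apply: eq_bigcapr => i /= is_.
- by rewrite /glue is_.
- by rewrite /glue (negbTE (s12 _ is_)).
Qed.

Lemma measurable_glue s B C : (forall i, measurable (B i)) ->
  (forall i, measurable (C i)) -> forall i, measurable (glue s B C i).
Proof. by move=> mB mC i; rewrite /glue; case: ifP. Qed.

Lemma indep_of_catl A s1 s2 : uniq (s1 ++ s2) ->
  indep_of A (s1 ++ s2) -> indep_of A s1.
Proof.
move=> u iA B mB.
have := iA (glue s1 B (fun=> setT)) (measurable_glue s1 mB (fun=> measurableT)).
by rewrite cylinder_glue// cylinder_setT setIT.
Qed.

Lemma indep_of_catr A s1 s2 : uniq (s1 ++ s2) ->
  indep_of A (s1 ++ s2) -> indep_of A s2.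
Proof.
move=> u iA B mB.
have := iA (glue s1 (fun=> setT) B) (measurable_glue s1 (fun=> measurableT) mB).
by rewrite cylinder_glue// cylinder_setT setTI.
Qed.

Lemma indep_of_cylinder A s1 s2 C : uniq (s1 ++ s2) ->
  (forall i, measurable (C i)) ->
  indep_of A (s1 ++ s2) -> indep_of (A `&` cylinder s2 C) s1.
Proof.
move=> u mC iA B mB.
have mBC := measurable_glue s1 mB mC.
rewrite -setIA [cylinder s2 C `&` _]setIC -cylinder_glue// iA//.
rewrite probability_cylinder_cat//.
have iA2 := indep_of_catr u iA.
rewrite (iA2 _ mC) -muleA [(P (cylinder s2 C) * _)%E]muleC.
have := u; rewrite cat_uniq => /and3P[_ /hasPn s12 _].
congr (_ * (P _ * P _))%E; apply: eq_bigcapr => i /= is_.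
- by rewrite /glue is_.
- by rewrite /glue (negbTE (s12 _ is_)).
Qed.

Definition block_indep s (f : T -> R) := forall A, measurable A ->
  indep_of A s -> forall B, measurable B ->
  P (A `&` f @^-1` B) = (P A * P (f @^-1` B))%E.

(** A cylinder over [s2] is absorbed into [A]; the event obtained is still independent of [s1],
    hence of [f]. *)
Lemma block_indep_of s1 s2 f A B : block_fun s1 f -> block_indep s1 f ->
  uniq (s1 ++ s2) -> measurable A -> measurable B ->
  indep_of A (s1 ++ s2) -> indep_of (A `&` f @^-1` B) s2.
Proof.
move=> bf inf u mA mB iA C mC.
have mAC : measurable (A `&` cylinder s2 C).
  by apply: measurableI => //; exact: measurable_cylinder.
rewrite setIAC (inf _ mAC (indep_of_cylinder u mC iA) _ mB).
have iA2 := indep_of_catr u iA; have iA1 := indep_of_catl u iA.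
by rewrite (iA2 _ mC) (inf _ mA iA1 _ mB) muleAC.
Qed.

(** Induction on the construction of [f]. For a pair, the event of [f1] is absorbed into [A], which
    stays independent of [s2], and the hypothesis on [f2] applies; this settles rectangles. *)
Lemma block_funP s f : uniq s -> block_fun s f -> block_indep s f.
Proof.
move=> + bf; elim: bf => [c _|i _|s1 s2 f1 f2 g bf1 IH1 bf2 IH2 mg us] A mA iA
  B mB.
- have [Bc|Bc] := pselect (B c).
    have -> : (fun=> c) @^-1` B = [set: T] by apply/seteqP; split.
    by rewrite setIT probability_setT mule1.
  have -> : (fun=> c) @^-1` B = set0 :> set T by apply/seteqP; split.
  by rewrite setI0 measure0 mule0.
- have := iA (fun=> B) (fun=> mB).
  rewrite /cylinder (_ : [set` [:: i]] = [set i]) ?bigcap_set1//.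
  by apply/seteqP; split => j /=; rewrite inE => /eqP.
have := us; rewrite cat_uniq => /and3P[u1 _ u2].
have {}IH1 := IH1 u1; have {}IH2 := IH2 u2.
have mf1 := block_fun_measurable bf1; have mf2 := block_fun_measurable bf2.
have rect A' B1 B2 : measurable A' -> indep_of A' (s1 ++ s2) ->
    measurable B1 -> measurable B2 ->
    P (A' `&` (f1 @^-1` B1 `&` f2 @^-1` B2)) =
    (P A' * (P (f1 @^-1` B1) * P (f2 @^-1` B2)))%E.
  move=> mA' iA' mB1 mB2.
  have mA1 : measurable (A' `&` f1 @^-1` B1).
    by apply: measurableI => //; exact: block_fun_preimage bf1 mB1.
  rewrite setIA (IH2 _ mA1 (block_indep_of bf1 IH1 us mA' mB1 iA'))//.
  by rewrite (IH1 _ mA' (indep_of_catl us iA') _ mB1) muleA.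
pose h t := (f1 t, f2 t).
have mh : measurable_fun setT h by exact: measurable_fun_pair.
have Afin : P A \is a fin_num by exact: fin_num_measure.
pose c := NngNum (fine_ge0 (measure_ge0 P A)).
(* From rectangles to Borel sets: the law of [h] restricted to [A] is compared with [P A] times the
   law of [h]. *)
suff : forall C, measurable C ->
    pushforward (mrestr P mA) h C = mscale c (pushforward P h) C.
  move=> /(_ mh (g @^-1` B)); rewrite /pushforward /mrestr /mscale /= fineK//.
  rewrite setIC; apply.
  by rewrite -[X in measurable X]setTI; exact: mg.
move=> mh'; apply: eq_measure_rectangles => [|B1 B2 mB1 mB2].
  by rewrite /= /pushforward /= /mrestr /= preimage_setT setTI ltey_eq Afin.
rewrite /= /pushforward /= /mrestr /mscale /= fineK// setIC.
have -> : h @^-1` (B1 `*` B2) = f1 @^-1` B1 `&` f2 @^-1` B2 by [].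
rewrite rect//; have := rect setT B1 B2 measurableT (indep_of_setT _) mB1 mB2.
by rewrite setTI probability_setT mul1e => <-.
Qed.

Lemma indep_of_preimage s1 s2 f A B : block_fun s1 f -> uniq (s1 ++ s2) ->
  measurable A -> measurable B ->
  indep_of A (s1 ++ s2) -> indep_of (A `&` f @^-1` B) s2.
Proof.
move=> bf u; have := u; rewrite cat_uniq => /and3P[u1 _ _].
exact: block_indep_of bf (block_funP u1 bf) u.
Qed.

Lemma block_fun_indep s1 s2 f1 f2 A B : block_fun s1 f1 -> block_fun s2 f2 ->
  uniq (s1 ++ s2) -> measurable A -> measurable B ->
  P (f1 @^-1` A `&` f2 @^-1` B) = (P (f1 @^-1` A) * P (f2 @^-1` B))%E.
Proof.
move=> bf1 bf2 u mA mB; have := u; rewrite cat_uniq => /and3P[_ _ u2].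
have i2 := indep_of_preimage bf1 u measurableT mA (@indep_of_setT _).
rewrite setTI in i2.
by apply: (block_funP u2 bf2) => //; exact: block_fun_preimage bf1 mA.
Qed.

End functions_of_blocks.

(** * Optional stopping *)

Section bounded_functions.
Context {d : measure_display} {T : measurableType d} {R : realType}.
Variable P : probability T R.

Definition bounded_meas (f : T -> R) : Prop :=
  measurable_fun setT f /\ exists K, forall t, `|f t| <= K.

Lemma bounded_meas_integrable f : bounded_meas f ->
  P.-integrable setT (EFin \o f).
Proof.
move=> [mf [K fK]]; apply: measurable_bounded_integrable => //.
  by rewrite ltey_eq fin_num_measure.
exists K; split; first exact: num_real.
by move=> x Kx t _ /=; apply: (le_trans (fK t)); exact: ltW.
Qed.

Lemma bounded_meas_cst c : bounded_meas (fun=> c).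
Proof. by split; [exact: measurable_cst|exists `|c|]. Qed.

Lemma bounded_measD f g : bounded_meas f -> bounded_meas g ->
  bounded_meas (fun t => f t + g t).
Proof.
move=> [mf [K fK]] [mg [K' gK]]; split; first exact: measurable_funD.
by exists (K + K') => t; rewrite (le_trans (ler_normD _ _))// lerD.
Qed.

Lemma bounded_measM f g : bounded_meas f -> bounded_meas g ->
  bounded_meas (fun t => f t * g t).
Proof.
move=> [mf [K fK]] [mg [K' gK]]; split; first exact: measurable_funM.
by exists (K * K') => t; rewrite normrM ler_pM.
Qed.

Lemma bounded_meas_indic (A : set T) : measurable A -> bounded_meas \1_A.
Proof.
move=> mA; split; first exact: measurable_indic.
by exists 1 => t; rewrite indicE ger0_norm ?ler0n// lern1 leq_b1.
Qed.

(* Independence makes the joint law of [X] and [Z] a product measure, so that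
   Fubini applies. *)
Lemma Rintegral_indepM (X Z : T -> R) :
  bounded_meas X -> bounded_meas Z ->
  (forall A B, measurable A -> measurable B ->
    P (X @^-1` A `&` Z @^-1` B) = (P (X @^-1` A) * P (Z @^-1` B))%E) ->
  \int[P]_t (X t * Z t) = (\int[P]_t X t) * \int[P]_t Z t.
Proof.
move=> bX bZ XZ; have [mX _] := bX; have [mZ _] := bZ.
pose X' : {mfun T >-> R} := HB.pack X (isMeasurableFun.Build _ _ _ _ X mX).
pose Z' : {mfun T >-> R} := HB.pack Z (isMeasurableFun.Build _ _ _ _ Z mZ).
pose h t := (X t, Z t).
have mh : measurable_fun setT h by exact: measurable_fun_pair.
pose h' : {mfun T >-> (R * R)%type} :=
  HB.pack h (isMeasurableFun.Build _ _ _ _ h mh).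
pose m1 := distribution P X'; pose m2 := distribution P Z'.
pose f (z : R * R) : \bar R := (z.1 * z.2)%:E.
have mf : measurable_fun setT f.
  apply/measurable_EFinP; apply: measurable_funM.
    exact: measurable_fst.
  exact: measurable_snd.
have intXZ : P.-integrable setT (f \o h').
  by apply: bounded_meas_integrable; exact: bounded_measM.
have joint C : measurable C -> (m1 \x m2)%E C = distribution P h' C.
  by move=> mC; apply: product_measure_unique => // A B mA mB; exact: XZ.
have intf : (m1 \x m2)%E.-integrable setT f.
  apply/integrableP; split => //.
  rewrite (_ : integral _ _ _ = \int[distribution P h']_z `|f z|)%E; last first.
    by apply: eq_measure_integral => C mC _; exact: joint.
  rewrite ge0_integral_distribution//; last exact: measurableT_comp.
  by have /integrableP[] := intXZ.
rewrite /Rintegral.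
have -> : (\int[P]_t (X t * Z t)%:E = \int[m1 \x m2]_z f z)%E.
  rewrite (_ : (integral _ _ f) = \int[distribution P h']_z f z)%E; last first.
    by apply: eq_measure_integral => C mC _; exact: joint.
  by rewrite integral_distribution.
rewrite -integral12_prod_meas1//.
have intX := bounded_meas_integrable bX.
have intZ := bounded_meas_integrable bZ.
have intZ' : m2.-integrable setT (@EFin R).
  by apply: integrable_pushforward => //.
have -> : fubini_F m2 f = fun x => (x%:E * \int[P]_t (Z t)%:E)%E.
  apply/funext => x; rewrite /fubini_F /f.
  under eq_integral do rewrite EFinM.
  rewrite integralZl// /m2 integral_distribution//.
  by apply/measurable_EFinP; exact: measurable_id.
have Zfin : (\int[P]_t (Z t)%:E)%E \is a fin_num by exact: integrable_fin_num.
have Xfin : (\int[P]_t (X t)%:E)%E \is a fin_num by exact: integrable_fin_num.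
have intX' : m1.-integrable setT (@EFin R).
  by apply: integrable_pushforward => //.
rewrite -{1}(fineK Zfin).
by rewrite integralZr//= /m1 integral_distribution ?fineM ?fineK.
Qed.

End bounded_functions.

(** * A centred walk frozen on leaving the interval from [- D] to [B] *)

Section stopped_walk.
Context {d : measure_display} {T : measurableType d} {R : realType}.
Variables (P : probability T R) (W xi : nat -> T -> R) (B D C s2 : R).
Hypotheses (B_ge0 : 0 <= B) (D_ge0 : 0 <= D).
Hypothesis W0 : forall t, W 0%N t = 0.
Hypothesis WS : forall n t,
  W n.+1 t = W n t + (if - D < W n t < B then xi n t else 0).
Hypotheses (mW : forall n, measurable_fun setT (W n))
  (mxi : forall n, measurable_fun setT (xi n)).
Hypothesis xiC : forall n t, `|xi n t| <= C.
Hypothesis Wxi : forall n (A A' : set R), measurable A -> measurable A' ->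
  P (W n @^-1` A `&` xi n @^-1` A') =
  (P (W n @^-1` A) * P (xi n @^-1` A'))%E.
Hypothesis mean_xi : forall n, \int[P]_t xi n t = 0.
Hypothesis var_xi : forall n, \int[P]_t (xi n t ^+ 2) = s2.

Let inside n t : R := (- D < W n t < B)%R%:R.

(** The walk moves only from inside the interval, so it overshoots by at most one step. *)
Lemma stopped_walk_bound n t : - (D + C) <= W n t <= B + C.
Proof.
have C0 : 0 <= C := le_trans (normr_ge0 _) (xiC 0%N t).
have [B0 D0] := (B_ge0, D_ge0).
elim: n => [|n IH]; first by rewrite W0; apply/andP; split; lra.
rewrite WS; case: ifP => [/andP[W1 W2]|_]; last by rewrite addr0.
by have := xiC n t; rewrite ler_norml => /andP[? ?]; apply/andP; split; lra.
Qed.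

Let bxi n : bounded_meas (xi n).
Proof. by split=> //; exists C. Qed.

Let bW n : bounded_meas (W n).
Proof.
split=> //; exists (B + D + C) => t; have /andP[? ?] := stopped_walk_bound n t.
have C0 : 0 <= C := le_trans (normr_ge0 _) (xiC 0%N t).
have [B0 D0] := (B_ge0, D_ge0).
by rewrite ler_norml; apply/andP; split; lra.
Qed.

Let phi (x : R) : R := \1_(`]- D, B[%classic) x.

Let mphi : measurable_fun setT phi.
Proof. by apply: measurable_indic; exact: measurable_itv. Qed.

Let insideE n : inside n = phi \o W n.
Proof.
apply/funext => t; rewrite /inside /phi /= indicE; congr (nat_of_bool _)%:R.
apply/idP/idP => [h|]; first by rewrite inE /= in_itv.
by rewrite inE /= in_itv.
Qed.

Let binside n : bounded_meas (inside n).
Proof.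
split; first by rewrite insideE; exact: measurableT_comp.
by exists 1 => t; rewrite /inside ger0_norm ?ler0n// lern1 leq_b1.
Qed.

Let Wxi_comp n (f g : R -> R) :
  measurable_fun setT f -> measurable_fun setT g ->
  bounded_meas (f \o W n) -> bounded_meas (g \o xi n) ->
  \int[P]_t (f (W n t) * g (xi n t)) =
  (\int[P]_t f (W n t)) * \int[P]_t g (xi n t).
Proof.
move=> mf mg bf bg.
rewrite (Rintegral_indepM (X := f \o W n) (Z := g \o xi n))//.
move=> A A' mA mA'; apply: (@Wxi n (f @^-1` A) (g @^-1` A')).
  by rewrite -[X in measurable X]setTI; exact: mf.
by rewrite -[X in measurable X]setTI; exact: mg.
Qed.

Let WSE n : W n.+1 = fun t => W n t + inside n t * xi n t.
Proof.
by apply/funext => t; rewrite WS /inside; case: ifP; rewrite ?mul1r ?mul0r.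
Qed.

Lemma stopped_walk_mean n : \int[P]_t W n t = 0.
Proof.
elim: n => [|n IH].
  under eq_Rintegral do rewrite W0.
  by rewrite Rintegral_cst// mul0r.
rewrite WSE RintegralD//; [|exact: bounded_meas_integrable|]; last first.
  by apply: bounded_meas_integrable; exact: bounded_measM.
have bphi : bounded_meas (phi \o W n) by rewrite -insideE.
rewrite IH add0r insideE (Wxi_comp mphi (@measurable_id _ _ _) bphi (bxi n)).
by rewrite mean_xi mulr0.
Qed.

(** Wald's second identity: the sum is the expected number of steps made before time [n]. The cross
    term vanishes because [xi n] is centred and independent of [W n]. *)
Lemma stopped_walk_var n :
  \int[P]_t (W n t ^+ 2) = s2 * \sum_(k < n) \int[P]_t inside k t.
Proof.
elim: n => [|n IH].
  under eq_Rintegral do rewrite W0 expr0n.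
  by rewrite Rintegral_cst// mul0r big_ord0 mulr0.
have bW2 : bounded_meas (fun t => W n t ^+ 2) by exact: bounded_measM.
have bxi2 : bounded_meas (fun t => xi n t ^+ 2) by exact: bounded_measM.
have bWi : bounded_meas (fun t => inside n t * W n t) by exact: bounded_measM.
have -> : \int[P]_t (W n.+1 t ^+ 2) = \int[P]_t (W n t ^+ 2 +
    (2 * ((inside n t * W n t) * xi n t) + inside n t * xi n t ^+ 2)).
  apply: eq_Rintegral => t _; rewrite WSE.
  by rewrite /inside; case: (_ < _ < _) => /=; ring.
have b2 : bounded_meas (fun t => (inside n t * W n t) * xi n t).
  exact: bounded_measM.
have b3 : bounded_meas (fun t => inside n t * xi n t ^+ 2).
  exact: bounded_measM.
have b2' : bounded_meas (fun t => 2 * ((inside n t * W n t) * xi n t)).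
  by apply: bounded_measM => //; exact: bounded_meas_cst.
rewrite RintegralD//; [|exact: bounded_meas_integrable|]; last first.
  by apply: bounded_meas_integrable; exact: bounded_measD.
rewrite RintegralD//; [|exact: bounded_meas_integrable..].
rewrite RintegralZl//; last exact: bounded_meas_integrable.
rewrite IH insideE.
have bphi : bounded_meas (phi \o W n) by rewrite -insideE.
have mphiM : measurable_fun setT (fun x => phi x * x) by exact: measurable_funM.
have bphiM : bounded_meas ((fun x => phi x * x) \o W n).
  by move: bWi; rewrite insideE.
rewrite (Wxi_comp mphiM (@measurable_id _ _ _) bphiM (bxi n)).
rewrite mean_xi mulr0 mulr0 add0r.
have msq : measurable_fun setT (fun x : R => x ^+ 2) by exact: measurable_funX.
rewrite (Wxi_comp mphi msq bphi bxi2).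
by rewrite var_xi big_ord_recr /= mulrDr insideE [X in _ + X]mulrC.
Qed.

Lemma stopped_walk_inside_le m n : (m <= n)%N ->
  \int[P]_t inside n t <= \int[P]_t inside m t.
Proof.
move=> /subnK <-; elim: (n - m)%N => [|k IH]; first by [].
apply: le_trans IH; apply: le_Rintegral => //;
  [exact: bounded_meas_integrable..|].
move=> t _; rewrite addSn /inside WS; case: ifP => [_|].
  by rewrite lern1 leq_b1.
by rewrite addr0 => ->.
Qed.

(** Wald's identity bounds the probability of being still inside by
    [(B + D + C) ^+ 2 / (n%:R * s2)], which [large] makes small; the zero mean then forces a
    definite chance of exit at the top. *)
Lemma stopped_walk_upcrossing n : 0 < s2 -> 0 < n%:R :> R ->
  (B + D) * (B + D + C) ^+ 2 <= D / 2 * (n%:R * s2) ->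
  D / 2 <= (B + D + C) * fine (P [set t | B <= W n t]).
Proof.
move=> s20 n0 large.
have mA : measurable [set t | B <= W n t].
  rewrite (_ : [set t | _] = W n @^-1` `[B, +oo[%classic).
    by rewrite -[X in measurable X]setTI; apply: mW => //; exact: measurable_itv.
  by apply/seteqP; split => t /=; rewrite in_itv /= andbT.
set p := fine _.
have pE : p = \int[P]_t \1_[set t | B <= W n t] t.
  by rewrite /Rintegral integral_indic// setIT.
set q := \int[P]_t inside n t.
have q0 : 0 <= q by apply: Rintegral_ge0 => t _; rewrite ler0n.
have bA := bounded_meas_indic mA.
have PT : fine (P setT) = 1 by rewrite probability_setT.
have qle : n%:R * s2 * q <= (B + D + C) ^+ 2.
  have : \int[P]_t (W n t ^+ 2) <= \int[P]_t ((B + D + C) ^+ 2).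
    apply: le_Rintegral => //.
    - by apply: bounded_meas_integrable; exact: bounded_measM.
    - by apply: bounded_meas_integrable; exact: bounded_meas_cst.
    move=> t _; have /andP[? ?] := stopped_walk_bound n t.
    have C0 : 0 <= C := le_trans (normr_ge0 _) (xiC 0%N t).
    have [B0 D0] := (B_ge0, D_ge0).
    rewrite -[W n t ^+ 2]real_normK ?num_real// lerXn2r ?nnegrE//.
      lra.
    by rewrite ler_norml; apply/andP; split; lra.
  rewrite Rintegral_cst// [fine _]PT mulr1; apply: le_trans.
  rewrite stopped_walk_var [n%:R * _]mulrC -mulrA ler_pM2l//.
  have -> : n%:R * q = \sum_(k < n) q by rewrite sumr_const card_ord mulr_natl.
  by apply: ler_sum => k _; apply: stopped_walk_inside_le; exact: ltnW.
(* The integrand on the right is [B + C], [B] or [- D] according to whether [W n] has reached [B],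
   is inside, or has left at the bottom. *)
have : \int[P]_t W n t <=
    \int[P]_t ((B + D + C) * \1_[set t | B <= W n t] t +
               ((B + D) * inside n t + - D)).
  have b1 : bounded_meas (fun t => (B + D + C) * \1_[set t | B <= W n t] t).
    by apply: bounded_measM => //; exact: bounded_meas_cst.
  have b2 : bounded_meas (fun t => (B + D) * inside n t + - D).
    apply: bounded_measD; last exact: bounded_meas_cst.
    by apply: bounded_measM => //; exact: bounded_meas_cst.
  apply: le_Rintegral => //.
  - exact: bounded_meas_integrable.
  - by apply: bounded_meas_integrable; exact: bounded_measD.
  move=> t _; have /andP[? ?] := stopped_walk_bound n t.
  have C0 : 0 <= C := le_trans (normr_ge0 _) (xiC 0%N t).
  have [B0 D0] := (B_ge0, D_ge0).
  rewrite indicE; have [BW|BW] := leP B (W n t).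
    rewrite mem_set//= mulr1; have : 0 <= (B + D) * inside n t.
      by rewrite mulr_ge0 ?ler0n//; lra.
    lra.
  rewrite memNset/=; last by apply/negP; rewrite -ltNge.
  rewrite mulr0 add0r /inside BW andbT.
  case: ltP => /= DW; lra.
rewrite stopped_walk_mean RintegralD//; last 2 first.
- apply: bounded_meas_integrable; apply: bounded_measM => //.
  exact: bounded_meas_cst.
- apply: bounded_meas_integrable; apply: bounded_measD.
    by apply: bounded_measM => //; exact: bounded_meas_cst.
  exact: bounded_meas_cst.
rewrite RintegralD//; last 2 first.
- apply: bounded_meas_integrable; apply: bounded_measM => //.
  exact: bounded_meas_cst.
- by apply: bounded_meas_integrable; exact: bounded_meas_cst.
rewrite !RintegralZl//; [|exact: bounded_meas_integrable..].
rewrite Rintegral_cst// [fine (P setT)]PT mulr1 -pE -/q => main.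
have : (B + D) * q <= D / 2.
  have ns : 0 < n%:R * s2 by rewrite mulr_gt0.
  rewrite -(ler_pM2l ns) mulrCA.
  apply: (le_trans _ (le_trans large _)); last by rewrite mulrC.
  by rewrite ler_wpM2l// addr_ge0.
lra.
Qed.

End stopped_walk.

(** * Valleys occur infinitely often *)

Section stopped_sequence.
Context {R : realType}.

Fixpoint stopped (B D : R) (x : nat -> R) (n : nat) : R :=
  if n is m.+1 then
    let s := stopped B D x m in s + (if - D < s < B then x m else 0)
  else 0.

(** The witness [m] is the exit time capped at [n]; the last alternative, still running or already
    out, carries the induction. *)
Lemma stopped_partial_sum (B D : R) x n : exists2 m, (m <= n)%N &
  [/\ stopped B D x n = \sum_(j < m) x j,
      forall i, (i < m)%N -> - D < \sum_(j < i) x j &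
      m = n \/ ~~ (- D < \sum_(j < m) x j < B)].
Proof.
elim: n => [|n [m mn [sm inm out]]] /=.
  by exists 0%N => //; split; [rewrite big_ord0| |left].
rewrite sm; case: ifPn => [ins|outs].
  case: out => [mE|]; last by rewrite ins.
  exists n.+1 => //; split; [by rewrite -mE big_ord_recr| |by left].
  move=> i; rewrite -mE ltnS leq_eqVlt => /orP[/eqP ->|/inm//].
  by case/andP: ins.
by exists m; [exact: leqW|split; [rewrite addr0|exact: inm|right]].
Qed.

(** The [n0] earlier increments contribute at least [- (n0%:R * C)], which is charged to both
    bounds. *)
Lemma stopped_upcrossing (B D C : R) x n0 n : 0 <= B -> 0 <= D ->
  (forall j, `|x j| <= C) -> B <= stopped B D (fun j => x (n0 + j)%N) n ->
  exists2 b, (b <= n0 + n)%N &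
    B - n0%:R * C <= \sum_(j < b) x j /\
    forall m, (m <= b)%N -> - (D + n0%:R * C) <= \sum_(j < m) x j.
Proof.
move=> B0 D0 xC.
have [m mn [-> inm _]] := stopped_partial_sum B D (fun j => x (n0 + j)%N) n.
move=> Bm; exists (n0 + m)%N; first by rewrite leq_add2l.
have C0 : 0 <= C := le_trans (normr_ge0 _) (xC 0%N).
have low k : - (k%:R * C) <= \sum_(j < k) x j.
  elim: k => [|k IH]; first by rewrite big_ord0 mul0r oppr0.
  rewrite big_ord_recr /= -natr1; have := xC k; rewrite ler_norml => /andP[? _].
  lra.
have splitS k : \sum_(j < n0 + k) x j =
    \sum_(j < n0) x j + \sum_(j < k) x (n0 + j)%N by rewrite big_split_ord.
split; first by rewrite splitS; have := low n0; lra.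
move=> k kle; have [kn|/ltnW nk] := leqP k n0.
  apply: le_trans (low k); have : k%:R * C <= n0%:R * C.
    by rewrite ler_wpM2r// ler_nat.
  lra.
rewrite -(subnKC nk) splitS; have := low n0.
(* At the final index the sum is at least [B], hence nonnegative; before it, the sum is above
   [- D]. *)
have [->|km] := eqVneq (k - n0)%N m; first by lra.
have := inm (k - n0)%N; rewrite ltn_neqAle km leq_subLR kle => /(_ isT).
lra.
Qed.

End stopped_sequence.

(** * Blocks of rapidly growing length *)

Section block_scales.
Variable K : nat.

(** Block [k] has length [block_height k ^ 3]: exit at the scale of the height takes about its
    square, and the extra factor beats the constants. A height of at least [K * block_start k]
    dominates the potential accumulated before; the summand [k.+1] sends it to infinity. *)
Fixpoint block_start (k : nat) : nat :=
  if k is k'.+1 then block_start k' + (K * (block_start k' + k)) ^ 3 else 0.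

Definition block_height (k : nat) : nat := (K * (block_start k + k.+1))%N.

Lemma block_startS k :
  block_start k.+1 = (block_start k + block_height k ^ 3)%N.
Proof. by []. Qed.

Lemma block_start_le_height k :
  (0 < K)%N -> (block_start k <= block_height k)%N.
Proof. by move=> K0; rewrite (leq_trans (leq_addr k.+1 _))// leq_pmull. Qed.

Lemma lt_block_height k : (0 < K)%N -> (k < block_height k)%N.
Proof.
by move=> K0; rewrite (leq_trans (leq_addl (block_start k) _))// leq_pmull.
Qed.

End block_scales.

(** * Success probability and independence of the blocks *)

Section random_valleys.
Context {d : measure_display} {T : measurableType d} {R : realType}.
Variables (P : probability T R) (omega : int -> {RV P >-> R}).
Hypothesis iid_omega : iid omega.
Variables (g : R -> R) (C s2 : R).
Hypotheses (mg : measurable_fun setT g) (gC : forall u, `|g u| <= C).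
Hypothesis mean_g : \int[P]_t g (omega 0 t) = 0.
Hypothesis var_g : \int[P]_t (g (omega 0 t) ^+ 2) = s2.
Hypothesis s2_gt0 : 0 < s2.
Variable delta : R.
Hypothesis delta01 : 0 < delta <= 1.

Definition side_index (s : bool) (j : nat) : int :=
  if s then j.+1%:Z else - j.+1%:Z.

(** [g] stands for a bounded version of [ln (rho u)]; the sign makes the sums on the left agree with
    [left_potential]. *)
Definition increment (s : bool) (j : nat) (t : T) : R :=
  (if s then 1 else -1) * g (omega (side_index s j) t).

Definition stopped_side (B D : R) (s : bool) (n0 n : nat) (t : T) : R :=
  stopped B D (fun j => increment s (n0 + j) t) n.

Definition side_block (s : bool) (n0 n : nat) : seq int :=
  [seq side_index s (n0 + j) | j <- iota 0 n].

Lemma side_index_inj s : injective (side_index s).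
Proof. by case: s => i j; rewrite /side_index; lia. Qed.

Lemma absz_side_index s j : `|side_index s j|%N = j.+1.
Proof. by case: s; rewrite /side_index; lia. Qed.

Lemma side_blockS s n0 n :
  side_block s n0 n.+1 = side_block s n0 n ++ [:: side_index s (n0 + n)].
Proof. by rewrite /side_block -[n.+1]addn1 iotaD map_cat. Qed.

Lemma side_block_uniq s n0 n : uniq (side_block s n0 n).
Proof.
rewrite map_inj_uniq ?iota_uniq// => i j /side_index_inj.
exact: addnI.
Qed.

Lemma mem_side_block s n0 n x : x \in side_block s n0 n ->
  (n0 < `|x| <= n0 + n)%N.
Proof.
move=> /mapP[j]; rewrite mem_iota add0n => /andP[_ jn] ->.
by rewrite absz_side_index ltnS leq_addr -addnS leq_add2l.
Qed.

Lemma side_blocks_uniq n0 n :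
  uniq (side_block true n0 n ++ side_block false n0 n).
Proof.
rewrite cat_uniq !side_block_uniq/= andbT; apply/hasPn => x.
move=> /mapP[j _ ->]; apply/negP => /mapP[i _].
by rewrite /side_index; lia.
Qed.

Lemma increment_measurable s j : measurable_fun setT (increment s j).
Proof.
by apply: measurable_funM => //; apply: measurableT_comp.
Qed.

Lemma increment_bound s j t : `|increment s j t| <= C.
Proof.
rewrite normrM; suff -> : `|if s then 1 else -1 : R| = 1 by rewrite mul1r.
by case: s; rewrite ?normrN normr1.
Qed.

Lemma Rintegral_coord (f : R -> R) x : measurable_fun setT f ->
  (exists K, forall u, `|f u| <= K) ->
  \int[P]_t f (omega x t) = \int[P]_t f (omega 0 t).
Proof.
move=> mf [K fK].
have bf y : bounded_meas (fun t => f (omega y t)).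
  by split; [exact: measurableT_comp|exists K].
rewrite /Rintegral; congr fine.
have E y : (\int[P]_t (f (omega y t))%:E =
    \int[distribution P (omega y)]_u (f u)%:E)%E.
  rewrite integral_distribution//; first exact/measurable_EFinP.
  exact: (bounded_meas_integrable P (bf y)).
rewrite !E; apply: eq_measure_integral => A mA _.
by have [_ ident] := iid_omega; exact: ident.
Qed.

Let bounded_g x : bounded_meas (fun t => g (omega x t)).
Proof. by split; [exact: measurableT_comp|exists C]. Qed.

Lemma increment_mean s j : \int[P]_t increment s j t = 0.
Proof.
rewrite RintegralZl//; last exact: (bounded_meas_integrable P (bounded_g _)).
by rewrite Rintegral_coord ?mean_g ?mulr0//; exists C.
Qed.

Lemma increment_var s j : \int[P]_t (increment s j t ^+ 2) = s2.
Proof.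
have -> : \int[P]_t (increment s j t ^+ 2) =
    \int[P]_t (g (omega (side_index s j) t) ^+ 2).
  by apply: eq_Rintegral => t _; rewrite /increment; case: s; ring.
rewrite (Rintegral_coord (f := fun u => g u ^+ 2)) ?var_g//.
  exact: measurable_funX.
by exists (C ^+ 2) => u; rewrite normrX lerXn2r ?nnegrE// (le_trans _ (gC u)).
Qed.

Lemma stopped_side_block B D s n0 n :
  block_fun omega (side_block s n0 n) (stopped_side B D s n0 n).
Proof.
elim: n => [|n IH]; first exact: block_cst.
rewrite side_blockS.
pose h (z : R * R) : R :=
  z.1 + \1_(`]- D, B[%classic) z.1 * ((if s then 1 else -1) * g z.2).
have -> : stopped_side B D s n0 n.+1 =
    fun t => h (stopped_side B D s n0 n t, omega (side_index s (n0 + n)) t).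
  apply/funext => t; rewrite /stopped_side /= /h /= indicE.
  rewrite mem_setE in_itv /=.
  by case: ifP => _; rewrite ?mul1r ?mul0r.
apply: block_pair => //; first exact: block_coord.
apply: measurable_funD; first exact: measurable_fst.
apply: measurable_funM.
  apply: measurableT_comp; last exact: measurable_fst.
  by apply: measurable_indic; exact: measurable_itv.
apply: measurable_funM => //.
by apply: measurableT_comp => //; exact: measurable_snd.
Qed.

(** Here [B + D <= 3 * M] and [B + D + C <= 4 * M]. Upcrossing by time [M ^ 3] asks for [3 * 4 ^ 2 *
    M ^ 3 <= delta * s2 * M ^ 4 / 4], whence 192, and yields [delta * M / 4] over [4 * M]. *)
Lemma stopped_side_prob (M : nat) s n0 : C <= M%:R ->
  192 <= delta * s2 * M%:R ->
  delta / 16 <=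
  fine (P [set t | 2 * M%:R <=
    stopped_side (2 * M%:R) (delta * M%:R / 2) s n0 (M ^ 3) t]).
Proof.
move=> CM large; have /andP[d0 d1] := delta01.
have s20 := s2_gt0.
have M0 : 0 < M%:R :> R.
  rewrite ltr0n lt0n; apply/eqP => M0; move: large; rewrite M0 mulr0.
  by rewrite leNgt ltr0n.
set B := 2 * M%:R; set D := delta * M%:R / 2.
have B0 : 0 <= B by rewrite mulr_ge0.
have D0 : 0 <= D by rewrite divr_ge0// mulr_ge0// ltW.
have C0 : 0 <= C := le_trans (normr_ge0 _) (gC 0).
have dM : delta * M%:R <= M%:R by nra.
have indep := proj1 iid_omega.
have := @stopped_walk_upcrossing _ _ _ P (stopped_side B D s n0)
  (fun n => increment s (n0 + n)) B D C s2 B0 D0.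
move=> /(_ (fun=> erefl) (fun n t => erefl)) /(_ _ _ _ _ _ _ (M ^ 3)%N s2_gt0).
set p := fine _ => H.
have {H} : D / 2 <= (B + D + C) * p.
  apply: H.
  - by move=> n; exact: block_fun_measurable (stopped_side_block _ _ _ _ _).
  - by move=> n; exact: increment_measurable.
  - by move=> n t; exact: increment_bound.
  - move=> n A A' mA mA'.
    have -> : increment s (n0 + n) @^-1` A' =
        omega (side_index s (n0 + n)) @^-1`
          ((fun u => (if s then 1 else -1) * g u) @^-1` A') by [].
    apply: (block_fun_indep indep (stopped_side_block B D s n0 n)
      (block_coord omega (side_index s (n0 + n)))) => //.
      by rewrite -side_blockS side_block_uniq.
    by rewrite -[X in measurable X]setTI; apply: measurable_funM.
  - by move=> n; exact: increment_mean.
  - by move=> n; exact: increment_var.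
  - by rewrite ltr0n expn_gt0 -(ltr0n R) M0.
  rewrite natrX.
  have h1 : (B + D + C) ^+ 2 <= (4 * M%:R) ^+ 2.
    by rewrite lerXn2r ?nnegrE ?addr_ge0 ?mulr_ge0//; rewrite /B /D; lra.
  have h2 : B + D <= 3 * M%:R by rewrite /B /D; lra.
  apply: (@le_trans _ _ (3 * M%:R * (4 * M%:R) ^+ 2)).
    by apply: ler_pM => //; rewrite ?addr_ge0// sqr_ge0.
  have -> : D / 2 * (M%:R ^+ 3 * s2) = M%:R ^+ 3 / 4 * (delta * s2 * M%:R).
    by rewrite /D; field.
  have -> : 3 * M%:R * (4 * M%:R) ^+ 2 = M%:R ^+ 3 / 4 * 192 :> R by field.
  by rewrite ler_wpM2l// divr_ge0// exprn_ge0.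
have p0 : 0 <= p by rewrite fine_ge0.
move=> h; have {h} : D / 2 <= 4 * M%:R * p.
  by apply: (le_trans h); rewrite ler_wpM2r// /B /D; lra.
have -> : D / 2 = 4 * M%:R * (delta / 16) by rewrite /D; field.
by rewrite ler_pM2l// mulr_gt0.
Qed.

Variable K : nat.
Hypotheses (C_le_K : C <= K%:R) (K_large : 192 <= delta * s2 * K%:R).

Let start := block_start K.
Let height := block_height K.

(** The minimum turns success on both sides into a level event of one block function. *)
Definition both_sides (k : nat) (t : T) : R :=
  Num.min
    (stopped_side (2 * (height k)%:R) (delta * (height k)%:R / 2) true
       (start k) (height k ^ 3) t)
    (stopped_side (2 * (height k)%:R) (delta * (height k)%:R / 2) false
       (start k) (height k ^ 3) t).

Definition two_sided_block (k : nat) : seq int :=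
  side_block true (start k) (height k ^ 3) ++
  side_block false (start k) (height k ^ 3).

Lemma both_sides_block k : block_fun omega (two_sided_block k) (both_sides k).
Proof.
apply: (block_pair (g := fun z : R * R => Num.min z.1 z.2)).
- exact: stopped_side_block.
- exact: stopped_side_block.
- by apply: measurable_minr; [exact: measurable_fst|exact: measurable_snd].
Qed.

Lemma mem_two_sided_block k x : x \in two_sided_block k ->
  (start k < `|x| <= start k.+1)%N.
Proof. by rewrite mem_cat => /orP[] /mem_side_block. Qed.

Lemma K_le_height k : (K <= height k)%N.
Proof. by rewrite /height /block_height addnS mulnS leq_addr. Qed.

Lemma both_sides_prob k :
  (delta / 16) ^+ 2 <= fine (P [set t | 2 * (height k)%:R <= both_sides k t]).
Proof.
have Kh : K%:R <= (height k)%:R :> R by rewrite ler_nat K_le_height.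
have Ch : C <= (height k)%:R := le_trans C_le_K Kh.
have /andP[d0 d1] := delta01.
have lh : 192 <= delta * s2 * (height k)%:R.
  by apply: (le_trans K_large); rewrite ler_wpM2l// mulr_ge0// ltW.
have pr s := stopped_side_prob s (start k) Ch lh.
pose I := `[2 * (height k)%:R : R, +oo[%classic.
have mI : measurable I by exact: measurable_itv.
have IE (f : T -> R) : [set t | 2 * (height k)%:R <= f t] = f @^-1` I.
  by apply/seteqP; split => t; rewrite /I /= in_itv /= andbT.
have -> : [set t | 2 * (height k)%:R <= both_sides k t] =
  stopped_side (2 * (height k)%:R) (delta * (height k)%:R / 2) true
       (start k) (height k ^ 3) @^-1` I `&`
  stopped_side (2 * (height k)%:R) (delta * (height k)%:R / 2) false
       (start k) (height k ^ 3) @^-1` I.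
  rewrite -!IE; apply/seteqP; split => t; rewrite /both_sides /= le_min.
    by move/andP.
  by move=> [-> ->].
have indep := proj1 iid_omega.
rewrite (block_fun_indep indep (stopped_side_block _ _ _ _ _)
  (stopped_side_block _ _ _ _ _) (side_blocks_uniq _ _))//.
rewrite fineM ?fin_num_measure//;
  [|exact: block_fun_preimage (stopped_side_block _ _ _ _ _) mI..].
rewrite expr2 -!IE; apply: ler_pM; rewrite ?divr_ge0 ?(ltW d0)//; exact: pr.
Qed.

Fixpoint miss (k0 j : nat) : set T :=
  if j is i.+1 then
    miss k0 i `&` both_sides (k0 + i) @^-1` `]-oo, 2 * (height (k0 + i))%:R[
  else setT.

Lemma measurable_miss k0 j : measurable (miss k0 j).
Proof.
elim: j => [|j IH] //=; apply: measurableI => //.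
by apply: block_fun_preimage (both_sides_block _) _; exact: measurable_itv.
Qed.

(** The blocks before [k0 + j] read only sites of modulus at most [start (k0 + j)]. The list [s] is
    arbitrary so that the induction can prepend a block to it. *)
Lemma miss_indep k0 j s : uniq s ->
  all (fun x => start (k0 + j) < `|x|)%N s -> indep_of omega (miss k0 j) s.
Proof.
have indep := proj1 iid_omega.
elim: j s => [|j IH] s us sj; first exact: indep_of_setT.
rewrite addnS in sj.
have ubs : uniq (two_sided_block (k0 + j) ++ s).
  rewrite cat_uniq side_blocks_uniq us andbT /=; apply/hasPn => x xs.
  apply/negP => /mem_two_sided_block /andP[_].
  by rewrite leqNgt (allP sj _ xs).
apply: (indep_of_preimage indep (both_sides_block (k0 + j)) ubs) => //.
- exact: measurable_miss.
- apply: IH => //; rewrite all_cat; apply/andP; split; apply/allP => x.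
    by move=> /mem_two_sided_block /andP[].
  move=> xs; apply: leq_ltn_trans (allP sj _ xs).
  by rewrite /start block_startS leq_addr.
Qed.

Lemma miss_prob k0 j :
  fine (P (miss k0 j)) <= (1 - (delta / 16) ^+ 2) ^+ j.
Proof.
have indep := proj1 iid_omega.
have /andP[d0 d1] := delta01.
elim: j => [|j IH] /=; first by rewrite probability_setT expr0.
have mJ : measurable (`]-oo, 2 * (height (k0 + j))%:R[ : set R).
  exact: measurable_itv.
rewrite (block_funP indep _ (both_sides_block (k0 + j))
  (measurable_miss k0 j))//.
- rewrite fineM ?fin_num_measure//; last 2 first.
  + exact: measurable_miss.
  + exact: block_fun_preimage (both_sides_block _) mJ.
  rewrite exprSr; apply: ler_pM; rewrite ?fine_ge0//.
  have -> : both_sides (k0 + j) @^-1` `]-oo, 2 * (height (k0 + j))%:R[ =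
      ~` [set t | 2 * (height (k0 + j))%:R <= both_sides (k0 + j) t].
    apply/seteqP; split => t /=; rewrite in_itv /= ltNge; first by move/negP.
    by move/negP.
  have mE : measurable
      [set t | 2 * (height (k0 + j))%:R <= both_sides (k0 + j) t].
    rewrite (_ : [set t | _] =
      both_sides (k0 + j) @^-1` `[2 * (height (k0 + j))%:R, +oo[).
      by apply: block_fun_preimage (both_sides_block _) _; exact: measurable_itv.
    by apply/seteqP; split => t /=; rewrite in_itv /= andbT.
  rewrite probability_setC// fineB ?fin_num_measure// lerD2l lerN2.
  exact: both_sides_prob.
- exact: side_blocks_uniq.
- apply: miss_indep; first exact: side_blocks_uniq.
  by apply/allP => x /mem_two_sided_block /andP[].
Qed.

(** The second Borel-Cantelli lemma by hand: the bound of [miss_prob] tends to 0 geometrically, for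
    each of the countably many [k0]. *)
Lemma infinitely_many_blocks : \forall t \ae P, forall k0, exists2 k,
  (k0 <= k)%N & 2 * (height k)%:R <= both_sides k t.
Proof.
apply: ae_foralln => k0.
have mU : measurable (\bigcap_j miss k0 j).
  by apply: bigcap_measurableType => j _; exact: measurable_miss.
have U0 : fine (P (\bigcap_j miss k0 j)) <= 0.
  have /andP[d0 d1] := delta01.
  pose r := 1 - (delta / 16) ^+ 2.
  have r1 : `|r| < 1.
    have : 0 < (delta / 16) ^+ 2 by rewrite exprn_gt0// divr_gt0.
    have : (delta / 16) ^+ 2 <= 1.
      by rewrite expr_le1// ?divr_ge0 ?ltW//; lra.
    by rewrite /r ltr_norml => ? ?; apply/andP; split; lra.
  have cr := cvg_expr r1.
  rewrite -(cvg_lim (@Rhausdorff R) cr).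
  apply: limr_ge; first by apply/cvg_ex; exists 0.
  apply: nearW => j; apply: le_trans (miss_prob k0 j).
  apply: fine_le; rewrite ?fin_num_measure//; first exact: measurable_miss.
  apply: le_measure; rewrite ?inE//; first exact: measurable_miss.
  by move=> t; exact.
exists (\bigcap_j miss k0 j); split => //.
- have : fine (P (\bigcap_j miss k0 j)) = 0.
    by apply/eqP; rewrite eq_le U0 fine_ge0.
  by move=> /(congr1 (@EFin R)); rewrite fineK ?fin_num_measure.
- move=> t /= nt j _; elim: j => [|j IH] //=; split=> //.
  rewrite /= in_itv /= ltNge; apply/negP => h; apply: nt.
  by exists (k0 + j)%N => //; exact: leq_addr.
Qed.

Hypotheses (K_wide : 2 * C <= delta * K%:R)
  (K_width : 120 <= delta ^+ 4 * K%:R).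

(** By [K_wide] the sites before the block contribute at most half of [delta] times the height, so a
    climb to twice the height leaves at least the height, and the two halves of the allowed descent
    add up. *)
Lemma valley_of_block t k :
  (forall x, g (omega x t) = ln (rho (omega x t))) ->
  2 * (height k)%:R <= both_sides k t ->
  valley (fun x => omega x t) delta (height k)%:R.
Proof.
move=> gE; rewrite /both_sides le_min => /andP[right left].
have /andP[d0 d1] := delta01.
have C0 : 0 <= C := le_trans (normr_ge0 _) (gC 0).
have K0 : (0 < K)%N.
  rewrite lt0n; apply/eqP => K0; move: K_width; rewrite K0 mulr0.
  by rewrite leNgt ltr0n.
have hE : (height k)%:R = K%:R * (start k)%:R + K%:R * k.+1%:R :> R.
  by rewrite -mulrDr -natrD -natrM.
have M1 : 1 <= (height k)%:R :> R.
  by rewrite ler1n (leq_trans K0)// K_le_height.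
have startC : (start k)%:R * C <= delta * (height k)%:R / 2.
  have kk : 0 <= delta * (K%:R * k.+1%:R) :> R by rewrite !mulr_ge0// ltW.
  have := ler_wpM2l (ler0n R (start k)) K_wide.
  rewrite hE; lra.
have dM : delta * (height k)%:R <= (height k)%:R.
  by rewrite -[leRHS]mul1r ler_wpM2r.
have B0 : 0 <= 2 * (height k)%:R :> R by rewrite mulr_ge0.
have D0 : 0 <= delta * (height k)%:R / 2 by rewrite divr_ge0// mulr_ge0// ltW.
have pot s j : increment s j t = if s then ln (rho (omega j.+1%:Z t))
    else - ln (rho (omega (- j.+1%:Z) t)).
  by rewrite /increment gE; case: s; rewrite ?mul1r ?mulN1r.
have [b bn [Bb lb]] := stopped_upcrossing B0 D0
  (fun j => increment_bound true j t) right.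
have [a an [Ba la]] := stopped_upcrossing B0 D0
  (fun j => increment_bound false j t) left.
have rp m : \sum_(j < m) increment true j t =
    right_potential (fun x => omega x t) m.
  by apply: eq_bigr => j _; rewrite pot.
have lp m : \sum_(j < m) increment false j t =
    left_potential (fun x => omega x t) m.
  by apply: eq_bigr => j _; rewrite pot.
exists a, b; split.
- by split; rewrite lt0n; apply/eqP => z; [move: Ba|move: Bb];
    rewrite z big_ord0; lra.
- by split; [rewrite -rp|rewrite -lp]; lra.
- by move=> m /lb; rewrite rp; lra.
- by move=> m /la; rewrite lp; lra.
(* Both ends are at most [start k + height k ^ 3], itself at most [2 * height k ^ 3]. The quartic
   term of the exponential beats [5 * height k ^ 3] once [delta ^+ 4 * height k] is at least
   [5 * 24 = 120]. *)
- apply: (@le_trans _ _ (5 * (height k)%:R ^+ 3)).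
    rewrite -natrX -natrM ler_nat.
    have sh : (start k <= height k)%N by exact: block_start_le_height.
    have h1 : (1 <= height k)%N by rewrite -(ler_nat R).
    have h3 : (height k <= height k ^ 3)%N.
      by rewrite -[X in (X <= _)%N]expn1 leq_pexp2l.
    move: an bn sh h1 h3; move: (height k ^ 3)%N (height k) (start k).
    by clear; lia.
  apply: le_trans (expR_ge1Dxn 3 _); last by rewrite mulr_ge0// ltW.
  have -> : 1 + (delta * (height k)%:R) ^+ 4 / 4`!%:R =
      1 + (height k)%:R ^+ 3 / 24 * (delta ^+ 4 * (height k)%:R) :> R.
    by rewrite (_ : 4`! = 24)%N//; field.
  have h120 : 120 <= delta ^+ 4 * (height k)%:R.
    apply: (le_trans K_width); rewrite ler_wpM2l ?exprn_ge0 ?(ltW d0)//.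
    by rewrite ler_nat K_le_height.
  apply: (@le_trans _ _ ((height k)%:R ^+ 3 / 24 * 120)).
    by rewrite le_eqVlt; apply/orP; left; apply/eqP; field.
  by rewrite ler_wpDl// ler_wpM2l// divr_ge0// exprn_ge0.
Qed.

Lemma ae_valleys :
  (\forall t \ae P, forall x, g (omega x t) = ln (rho (omega x t))) ->
  \forall t \ae P, forall h0, exists2 h, h0 <= h &
    valley (fun x => omega x t) delta h.
Proof.
move=> gE; have hits := infinitely_many_blocks; near=> t.
have gt : forall x, g (omega x t) = ln (rho (omega x t)) by near: t.
have ht : forall k0, exists2 k,
    (k0 <= k)%N & 2 * (height k)%:R <= both_sides k t by near: t.
move=> h0; have [k kge hk] := ht (Num.trunc h0).
exists (height k)%:R; last exact: valley_of_block.
apply: ltW; apply: (lt_le_trans (truncnS_gt h0)); rewrite ler_nat.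
have K0 : (0 < K)%N.
  rewrite lt0n; apply/eqP => K0; move: K_width; rewrite K0 mulr0.
  by rewrite leNgt ltr0n.
exact: leq_ltn_trans kge (lt_block_height _ K0).
Unshelve. all: by end_near. Qed.

End random_valleys.

(** * A bounded version of the logarithm of [rho] *)

Section log_ratio.
Context {R : realType}.
Variable eps : R.
Hypotheses (eps_gt0 : 0 < eps) (eps_lt : eps < 1 / 2).

Definition clamp (u : R) : R := Num.max eps (Num.min u (1 - eps)).

(** Bounded on the whole line, so that the increments are bounded at every sample point and not
    merely almost surely. *)
Definition clamped_log_rho (u : R) : R := ln (1 - clamp u) - ln (clamp u).

Lemma ln_rho (u : R) : 0 < u < 1 -> ln (rho u) = ln (1 - u) - ln u.
Proof.
by move=> /andP[u0 u1]; rewrite /rho lnM ?posrE ?subr_gt0 ?invr_gt0// lnV.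
Qed.

Lemma clamp_itv u : eps <= clamp u <= 1 - eps.
Proof.
have [e0 e1] := (eps_gt0, eps_lt).
by rewrite /clamp le_max lexx /= ge_max ge_min lexx orbT andbT; lra.
Qed.

Lemma clamp_id u : eps <= u <= 1 - eps -> clamp u = u.
Proof. by move=> /andP[eu ue]; rewrite /clamp min_l// max_r. Qed.

Lemma clamped_log_rhoE u : eps <= u <= 1 - eps ->
  clamped_log_rho u = ln (rho u).
Proof.
move=> uI; have /andP[eu ue] := uI; have [e0 e1] := (eps_gt0, eps_lt).
rewrite /clamped_log_rho clamp_id// ln_rho//; lra.
Qed.

Lemma clamped_log_rho_measurable : measurable_fun setT clamped_log_rho.
Proof.
have mc : measurable_fun setT clamp.
  by apply: measurable_maxr => //; exact: measurable_minr.
apply: measurable_funB; apply: measurableT_comp => //; try exact: measurable_ln.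
exact: measurable_funB.
Qed.

(** Both logarithms lie between [ln eps] and 0. *)
Lemma clamped_log_rho_bound u : `|clamped_log_rho u| <= - ln eps.
Proof.
have /andP[eu ue] := clamp_itv u; have [e0 e1] := (eps_gt0, eps_lt).
have b v : eps <= v -> v <= 1 -> ln eps <= ln v <= 0.
  move=> ev v1; have v0 : 0 < v by exact: lt_le_trans ev.
  by rewrite ler_ln ?posrE// ev ln_le0.
have := b (clamp u) eu; have := b (1 - clamp u).
rewrite /clamped_log_rho ler_norml => h1 h2.
have /andP[? ?] : ln eps <= ln (clamp u) <= 0 by apply: h2; lra.
have /andP[? ?] : ln eps <= ln (1 - clamp u) <= 0 by apply: h1; lra.
by apply/andP; split; lra.
Qed.

End log_ratio.

(** * From the hypotheses on the environment to almost sure divergence *)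

Unset Implicit Arguments.

Theorem theorem4p1 (R : realType) (d : measure_display) (T : measurableType d)
    (P : probability T R) (omega : int -> {RV P >-> R})
    (env_omega : random_environment omega)
    (mean0 : 'E_P[fun t => ln (rho (omega 0%R t))]%E = 0%E)
    (elliptic : exists eps : R, 0 < eps < 1 / 2 /\
       P [set t | eps <= omega 0 t <= 1 - eps] = 1%E)
    (var_gt0 : (0 < 'V_P[fun t => ln (rho (omega 0%R t))])%E)
    (alpha : R) (alpha01 : 0 <= alpha < 1) :
  \forall t \ae P,
    forall (d' : measure_display) (T' : measurableType d')
      (Q : probability T' R) (X : nat -> T' -> int),
    walk_in_environment Q (fun x => omega x t) 0 X ->
    (\sum_(1 <= n <oo)
       (Q [set s | X (2 * n)%N s = 0%R] * (n%:R `^ (- alpha))%R%:E) = +oo)%E.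
Proof.
have [iid_omega omega01] := env_omega.
have [eps [/andP[eps0 eps12] Peps]] := elliptic.
have /andP[alpha0 alpha1] := alpha01.
pose g := clamped_log_rho eps; pose C := - ln eps.
have mg : measurable_fun setT g := clamped_log_rho_measurable eps.
have gC u : `|g u| <= C := clamped_log_rho_bound eps0 eps12 u.
have bg : bounded_meas (fun t => g (omega 0 t)).
  by split; [exact: measurableT_comp|exists C].
have bg2 : bounded_meas (fun t => g (omega 0 t) ^+ 2) by exact: bounded_measM.
have ellx x : \forall t \ae P, eps <= omega x t <= 1 - eps.
  pose I := `[eps, 1 - eps]%classic.
  have mI : measurable I by exact: measurable_itv.
  have mA : measurable (omega x @^-1` I).
    by rewrite -[X in measurable X]setTI; apply: measurable_funPT.
  exists (~` (omega x @^-1` I)); split; first exact: measurableC.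
    have -> : P (~` (omega x @^-1` I)) = (1 - P (omega x @^-1` I))%E.
      exact: probability_setC.
    have -> : P (omega x @^-1` I) = P (omega 0 @^-1` I).
      by have [_ ident] := iid_omega; exact: ident.
    rewrite (_ : _ @^-1` I = [set t | eps <= omega 0 t <= 1 - eps])//.
    by rewrite Peps subee.
  by move=> t /= nt; rewrite /I /= in_itv.
(* Countably many sites: [int] is split along its constructors into two families indexed by
   [nat]. *)
have ell : \forall t \ae P, forall x, eps <= omega x t <= 1 - eps.
  have pos := ae_foralln (fun n => ellx (Posz n)).
  have neg := ae_foralln (fun n => ellx (Negz n)).
  near=> t; case => n; move: n; near: t; [exact: pos|exact: neg].
have mL : measurable_fun setT (fun t => ln (rho (omega 0 t))).
  rewrite (_ : (fun t => _) = fun t => ln (1 - omega 0 t) - ln (omega 0 t)).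
    apply: measurable_funB; apply: measurableT_comp => //;
      try exact: measurable_ln.
    exact: measurable_funB.
  by apply/funext => t; rewrite ln_rho.
have gE : \forall t \ae P, g (omega 0 t) = ln (rho (omega 0 t)).
  by apply: filterS (ellx 0) => t; exact: clamped_log_rhoE.
have mean_g : \int[P]_t g (omega 0 t) = 0.
  rewrite /Rintegral -[RHS]/(fine 0%E) -mean0 unlock; congr fine.
  apply: ae_eq_integral => //.
  - by apply/measurable_EFinP; case: bg.
  - exact/measurable_EFinP.
  - by apply: filterS gE => t /= -> _.
pose s2 := \int[P]_t (g (omega 0 t) ^+ 2).
(* Since the mean vanishes, the variance is the second moment, which is unchanged by clamping. *)
have s2_gt0 : 0 < s2.
  apply: fine_gt0; apply/andP; split; last first.
    by rewrite ltey_eq (integrable_fin_num _ (bounded_meas_integrable P bg2)).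
  move: var_gt0; rewrite /variance unlock mean0 unlock.
  rewrite (_ : integral _ _ _ = \int[P]_t (g (omega 0 t) ^+ 2)%:E)%E//.
  apply: ae_eq_integral => //.
  - apply/measurable_EFinP; apply: measurable_funM; exact: measurable_funB.
  - by apply/measurable_EFinP; case: bg2.
  - have sq (x : R) : (x - fine 0%E) * (x - fine 0%E) = x ^+ 2.
      by rewrite subr0 expr2.
    by apply: filterS gE => t gt _; rewrite gt; congr EFin; exact: sq.
pose delta := (1 - alpha) / 4.
have delta01 : 0 < delta <= 1.
  by apply/andP; split; rewrite /delta; lra.
have /andP[d0 d1] := delta01.
have [K [K1 K2 K3 K4]] : exists K : nat, [/\ C <= K%:R,
    192 <= delta * s2 * K%:R, 2 * C <= delta * K%:R &
    120 <= delta ^+ 4 * K%:R].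
  (* The sum of the four thresholds for [K], each made nonnegative. *)
  pose y := `|C| + 192 / (delta * s2) + 2 * `|C| / delta + 120 / delta ^+ 4.
  have ds : 0 < delta * s2 by rewrite mulr_gt0.
  have d4 : 0 < delta ^+ 4 by rewrite exprn_gt0.
  have y1 : 0 <= 192 / (delta * s2) by rewrite divr_ge0// ltW.
  have y2 : 0 <= 2 * `|C| / delta.
    by apply: divr_ge0; [exact: mulr_ge0|exact: ltW].
  have y3 : 0 <= 120 / delta ^+ 4 by rewrite divr_ge0// ltW.
  have C0 := normr_ge0 C; have CC := ler_norm C.
  have yK : y <= (Num.trunc y).+1%:R by apply/ltW/truncnS_gt.
  exists (Num.trunc y).+1; split.
  - by apply: le_trans yK; rewrite /y; lra.
  - by rewrite -ler_pdivrMl// mulrC; apply: le_trans yK; rewrite /y; lra.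
  - rewrite -ler_pdivrMl// mulrC; apply: (@le_trans _ _ (2 * `|C| / delta)).
      by rewrite ler_wpM2r ?invr_ge0 ?(ltW d0)// ler_wpM2l.
    by apply: le_trans yK; rewrite /y; lra.
  - by rewrite -ler_pdivrMl// mulrC; apply: le_trans yK; rewrite /y; lra.
have gEx : \forall t \ae P, forall x, g (omega x t) = ln (rho (omega x t)).
  by apply: filterS ell => t et x; exact: clamped_log_rhoE.
have valleys := ae_valleys iid_omega mg gC mean_g erefl s2_gt0 delta01
  K1 K2 K3 K4 gEx.
(* The walk is introduced after the environment: the exceptional null set does not depend on it. *)
near=> t => d' T' Q X walkX.
have ellt : forall x, eps <= omega x t <= 1 - eps by near: t.
apply: (valleys_divergence eps0 ellt alpha01 walkX).
by near: t.
Unshelve. all: by end_near. Qed.
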